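(* Let $R$ be an overt commutative localic semiring and suppose that the suplattice $\mathscr{S}R$ of saturated opens of $R$ is dualisable in $\mathbf{Sup}$. Then the functor $\overline{\mathrm{OPAI}}_R\colon \mathbf{Quant}_\top \to \mathbf{Set}$ is representable, with representing object the quantale of ideals $\mathrm{Idl}(R)$ and universal element $(\mathfrak{s} \otimes \kappa)\eta(\top) \in \mathrm{Idl}(R) \otimes \mathcal{O}R$, where $\eta\colon \Omega \to \mathscr{M}R \otimes \mathscr{S}R$ is the unit of the duality between $\mathscr{S}R$ and $\mathscr{M}R$.
   Context: Everything is constructive (valid in any elementary topos with natural numbers object). $\Omega$ is the frame of truth values. $\mathbf{Sup}$ is the category of suplattices (posets with arbitrary joins, join-preserving maps), symmetric monoidal closed with tensor $\otimes$ (classifying maps preserving joins in each variable), unit $\Omega$, and internal hom $\hom(-,-)$ ordered pointwise; $\Delta\colon\Omega\otimes\Omega\cong\Omega$. Quantales are commutative monoids in $\mathbf{Sup}$; a quantale is two-sided if its unit is its top element. $\mathbf{Quant}_\top$ is the category of two-sided quantales and quantale homomorphisms. Frames are the two-sided quantales with idempotent multiplication; the coproduct $Q\oplus Q'$ of two-sided quantales (or frames) has underlying suplattice $Q\otimes Q'$ with componentwise multiplication. For a locale $X$, $\mathcal{O}X$ is its frame of opens. $X$ is overt if $\mathcal{O}X$ has a base of positive elements ($a$ is positive if $a\le\bigvee I$ implies $I$ is inhabited); equivalently, the locale map $X\to 1$ is open. A commutative localic semiring $R$ is a commutative semiring object (with $0$ and $1$) in locales; $\epsilon_0,\epsilon_1\colon\mathcal{O}R\to\Omega$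 and $\mu_+,\mu_\times\colon\mathcal{O}R\to\mathcal{O}R\oplus\mathcal{O}R$ are the frame maps corresponding to zero, one, addition and multiplication; $\iota_1,\iota_2\colon\mathcal{O}R\to\mathcal{O}R\oplus\mathcal{O}R$ are the coproduct injections. $\overline{\mathrm{OPAI}}_R(Q)$ is the set of $u\in Q\oplus\mathcal{O}R$ such that $(Q\oplus\epsilon_0)(u)=0$, $(Q\oplus\epsilon_1)(u)=1$, $(Q\oplus\mu_+)(u)\le(Q\oplus\iota_1)(u)\vee(Q\oplus\iota_2)(u)$ and $(Q\oplus\mu_\times)(u)=(Q\oplus\iota_1)(u)\cdot(Q\oplus\iota_2)(u)$; a morphism $g\colon Q\to Q'$ acts by $u\mapsto(g\oplus\mathcal{O}R)(u)$. Saturated opens: $\mathscr{S}R=\{s\in\mathcal{O}R\mid\mu_\times(s)\le\iota_1(s)\}$, a subframe with inclusion $\kappa\colon\mathscr{S}R\hookrightarrow\mathcal{O}R$. Overt weakly closed sublocales of $R$ are identified with elements of $\hom(\mathcal{O}R,\Omega)$. This suplattice is a quantale under $f\cdot g=\Delta(f\otimes g)\mu_\times$ with unit $\epsilon_1$, and also under $f+g=\Delta(f\otimes g)\mu_+$ with unit $0_+=\epsilon_0$. A monoid ideal is $I\in\hom(\mathcal{O}R,\Omega)$ with $I=I\cdot\top$; the quantale of monoid ideals $\mathscr{M}R$ is the two-sided reflection of the multiplicative quantale $\hom(\mathcal{O}R,\Omega)$, i.e. the quotient by the nucleus $W\mapsto W\cdot\top$, whose elements are the monoid ideals. An ideal is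 a monoid ideal $I$ with $0_+\le I$ and $I+I\le I$. $\mathrm{Idl}(R)$ is the quotient of the multiplicative quantale $\hom(\mathcal{O}R,\Omega)$ by the quantale congruence generated by $1=\top$, $0_+=0$ and $a+b\le a\vee b$ for all $a,b$ ($0$ being the least element); ideals are exactly the largest elements of the congruence classes. The quotient map factors through a quotient map $\mathfrak{s}\colon\mathscr{M}R\to\mathrm{Idl}(R)$. When $R$ is overt, $\mathscr{M}R\cong\hom(\mathscr{S}R,\Omega)$ via $h\mapsto h\kappa$; so if $\mathscr{S}R$ is dualisable, its dual is $\mathscr{M}R$, with counit $\mathscr{S}R\otimes\mathscr{M}R\to\Omega$ given by evaluation and unit $\eta$ determined by the triangle identities. *)

(* Defs.v *)
From Corelib Require Import ssreflect ssrfun ssrbool.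
From Stdlib Require Import Relation_Definitions.
From Stdlib Require Import FunctionalExtensionality PropExtensionality ProofIrrelevance.

Set Implicit Arguments.
Unset Strict Implicit.
Unset Printing Implicit Defensive.

(* Everything here is constructive: truth values are propositions ([Prop]), a
   subset of [T] is a predicate [T -> Prop], and the only axioms used are
   propositional and functional extensionality and proof irrelevance, all of
   which hold in the internal logic of a topos. *)

Definition image (A B : Type) (f : A -> B) (S : A -> Prop) : B -> Prop :=
  fun b => exists2 a, S a & f a = b.

Record suplattice : Type := Suplattice {
  sl_sort :> Type;
  le : relation sl_sort;
  sup : (sl_sort -> Prop) -> sl_sort;
  le_order : order sl_sort le;
  supP : forall S x, le (sup S) x <-> (forall s, S s -> le s x) }.

Notation "x ⊑ y" := (le x y) (at level 70, no associativity).
Notation "⋁ S" := (sup S) (at level 35, right associativity).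

Definition bot (A : suplattice) : A := ⋁ (fun _ => False).
Definition top (A : suplattice) : A := ⋁ (fun _ => True).
Definition join (A : suplattice) (a b : A) : A := ⋁ (fun x => x = a \/ x = b).

Section SuplatticeTheory.
Variable A : suplattice.
Implicit Types (x y z : A) (S : A -> Prop).

Lemma le_refl x : x ⊑ x.
Proof. by case: (le_order A) => r _ _; apply: r. Qed.

Lemma le_trans y x z : x ⊑ y -> y ⊑ z -> x ⊑ z.
Proof. by case: (le_order A) => _ t _; apply: t. Qed.

Lemma le_anti x y : x ⊑ y -> y ⊑ x -> x = y.
Proof. by case: (le_order A) => _ _ a; apply: a. Qed.

Lemma sup_ub S x : S x -> x ⊑ ⋁ S.
Proof. by move: x; apply/supP; apply: le_refl. Qed.

Lemma sup_lub S x : (forall s, S s -> s ⊑ x) -> ⋁ S ⊑ x.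
Proof. by move=> h; apply/supP. Qed.

Lemma eq_ub x y : (forall z, x ⊑ z <-> y ⊑ z) -> x = y.
Proof.
by move=> h; apply: le_anti; [apply/(h y)|apply/(h x)]; apply: le_refl.
Qed.

Lemma le_top x : x ⊑ top A.
Proof. exact: sup_ub. Qed.

Lemma bot_le x : bot A ⊑ x.
Proof. by apply: sup_lub. Qed.

Lemma joinP x y z : join x y ⊑ z <-> x ⊑ z /\ y ⊑ z.
Proof.
split=> [h|[hx hy]].
  by split; apply: le_trans h; apply: sup_ub; [left|right].
by apply: sup_lub => s [] ->.
Qed.

Lemma sup1 x : ⋁ (fun y => y = x) = x.
Proof.
apply: eq_ub => z; rewrite supP; split=> [|h _ ->//]; exact.
Qed.

Lemma join_le x y : x ⊑ y -> join x y = y.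
Proof.
move=> h; apply: eq_ub => z; rewrite joinP; split=> [[]//|hy].
by split=> //; apply: le_trans hy.
Qed.

Lemma eq_sup S T : (forall x, S x <-> T x) -> ⋁ S = ⋁ T.
Proof.
by move=> h; apply: eq_ub => z; rewrite !supP; split=> k s /h; apply: k.
Qed.

End SuplatticeTheory.

Lemma sup_imageP (T : Type) (A : suplattice) (f : T -> A) (S : T -> Prop) z :
  ⋁ (image f S) ⊑ z <-> (forall s, S s -> f s ⊑ z).
Proof.
rewrite supP; split=> [h s Ss|h _ [s Ss <-]]; last exact: h.
by apply: h; exists s.
Qed.

Lemma eq_sup_image (T : Type) (A : suplattice) (f g : T -> A) (S : T -> Prop) :
  (forall s, S s -> f s = g s) -> ⋁ (image f S) = ⋁ (image g S).
Proof.
move=> h; apply: eq_ub => z; rewrite !sup_imageP.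
by split=> k s Ss; [rewrite -h|rewrite h] => //; apply: k.
Qed.

Lemma sup_image_sup (T U : Type) (A : suplattice) (f : T -> U -> A) P S :
  ⋁ (image (fun t => ⋁ (image (f t) S)) P) =
  ⋁ (image (fun u => ⋁ (image (f^~ u) P)) S).
Proof.
apply: eq_ub => z; rewrite !sup_imageP.
by split=> h s Ss; apply/sup_imageP => t Pt; move/sup_imageP: (h _ Pt); apply.
Qed.

Record sup_hom (A B : suplattice) : Type := SupHom {
  sh_fun :> A -> B;
  sh_sup : forall S, sh_fun (⋁ S) = ⋁ (image sh_fun S) }.

Lemma sup_hom_eq (A B : suplattice) (f g : sup_hom A B) : f =1 g -> f = g.
Proof.
case: f g => [f hf] [g hg] /= /functional_extensionality e.
by case: _ / e hg => hg; congr SupHom; apply: proof_irrelevance.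
Qed.

Lemma sh_mono (A B : suplattice) (f : sup_hom A B) x y : x ⊑ y -> f x ⊑ f y.
Proof.
move=> h; rewrite -(join_le h) sh_sup; apply: sup_ub.
by exists x => //; left.
Qed.

Lemma sh_id_subproof (A : suplattice) (S : A -> Prop) : id (⋁ S) = ⋁ (image id S).
Proof. by apply: eq_ub => z; rewrite sup_imageP supP. Qed.
Definition sh_id (A : suplattice) : sup_hom A A := SupHom (@sh_id_subproof A).

Lemma sup_image_comp (T U : Type) (A : suplattice) (f : T -> U) (g : U -> A) S :
  ⋁ (image g (image f S)) = ⋁ (image (fun x => g (f x)) S).
Proof.
apply: eq_ub => z; rewrite !sup_imageP; split=> h s.
  by move=> Ss; apply: h; exists s.
by move=> [t St <-]; apply: h.
Qed.

Lemma sh_comp_subproof (A B C : suplattice) (g : sup_hom B C) (f : sup_hom A B) S :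
  g (f (⋁ S)) = ⋁ (image (fun x => g (f x)) S).
Proof. by rewrite !sh_sup sup_image_comp. Qed.
Definition sh_comp (A B C : suplattice) (g : sup_hom B C) (f : sup_hom A B) :
  sup_hom A C := SupHom (@sh_comp_subproof A B C g f).

Notation "g ∘ f" := (sh_comp g f) (at level 40, left associativity).

Lemma sh_compE (A B C : suplattice) (g : sup_hom B C) (f : sup_hom A B) a :
  (g ∘ f) a = g (f a).
Proof. by []. Qed.

Lemma sh_idE (A : suplattice) (a : A) : sh_id A a = a.
Proof. by []. Qed.

Section Hom.
Variables A B : suplattice.

Definition hom_le : relation (sup_hom A B) := fun f g => forall a, f a ⊑ g a.

Lemma hom_sup_subproof (F : sup_hom A B -> Prop) S :
  ⋁ (image (fun f : sup_hom A B => f (⋁ S)) F) =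
  ⋁ (image (fun a => ⋁ (image (fun f : sup_hom A B => f a) F)) S).
Proof. by rewrite -sup_image_sup; apply: eq_sup_image => f _; rewrite sh_sup. Qed.

Definition hom_sup (F : sup_hom A B -> Prop) : sup_hom A B :=
  SupHom (hom_sup_subproof F).

Lemma hom_order : order _ hom_le.
Proof.
split=> [f a|f g h fg gh a|f g fg gf]; first exact: le_refl.
  exact: le_trans (gh a).
by apply: sup_hom_eq => a; apply: le_anti.
Qed.

Lemma hom_supP F f : hom_le (hom_sup F) f <-> (forall g, F g -> hom_le g f).
Proof.
split=> [h g Fg a|h a]; first by move/sup_imageP: (h a); apply.
by apply/sup_imageP => g Fg; apply: h.
Qed.

Definition hom : suplattice := Suplattice hom_order hom_supP.

Lemma hom_supE (F : hom -> Prop) a :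
  sh_fun (⋁ F : hom) a = ⋁ (image (fun f : hom => sh_fun f a) F).
Proof. by []. Qed.

End Hom.

Record bihom (A B C : suplattice) : Type := Bihom {
  bh_fun :> A -> B -> C;
  bh_supl : forall S b, bh_fun (⋁ S) b = ⋁ (image (bh_fun^~ b) S);
  bh_supr : forall a S, bh_fun a (⋁ S) = ⋁ (image (bh_fun a) S) }.

(* An element t of the tensor product is represented by the relation
   {(a, b) | a ⊗ b ≤ t}. The relations arising in this way are those for which
   (⋁ S, b) is related iff all (s, b), s in S, are, and symmetrically. The
   universal property is given by [lift], [liftE] and [tensor_ext] below. *)
Record biideal (A B : suplattice) : Type := Biideal {
  bi_rel :> A -> B -> Prop;
  bi_supl : forall S b, bi_rel (⋁ S) b <-> (forall a, S a -> bi_rel a b);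
  bi_supr : forall a S, bi_rel a (⋁ S) <-> (forall b, S b -> bi_rel a b) }.

Section Tensor.
Variables A B : suplattice.

Definition bi_le : relation (biideal A B) :=
  fun U V => forall a b, U a b -> V a b.

Lemma biideal_eq (U V : biideal A B) : bi_le U V -> bi_le V U -> U = V.
Proof.
case: U V => [u u1 u2] [v v1 v2]; rewrite /bi_le /= => uv vu.
have e : u = v.
  apply: functional_extensionality => a; apply: functional_extensionality => b.
  by apply: propositional_extensionality; split=> [/uv|/vu].
by case: _ / e v1 v2 {uv vu} => v1 v2; congr Biideal; apply: proof_irrelevance.
Qed.

Definition generated_rel (P : A -> B -> Prop) : A -> B -> Prop :=
  fun a b => forall V : biideal A B, (forall x y, P x y -> V x y) -> V a b.

Lemma generated_supl P S b :
  generated_rel P (⋁ S) b <-> (forall a, S a -> generated_rel P a b).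
Proof.
split=> [h a Sa V PV|h V PV]; first by move/bi_supl: (h V PV); apply.
by apply/bi_supl => a Sa; apply: h.
Qed.

Lemma generated_supr P a S :
  generated_rel P a (⋁ S) <-> (forall b, S b -> generated_rel P a b).
Proof.
split=> [h b Sb V PV|h V PV]; first by move/bi_supr: (h V PV); apply.
by apply/bi_supr => b Sb; apply: h.
Qed.

Definition generated (P : A -> B -> Prop) : biideal A B :=
  Biideal (generated_supl P) (generated_supr P).

Lemma generatedP P (V : biideal A B) :
  bi_le (generated P) V <-> (forall a b, P a b -> V a b).
Proof. by split=> [h a b Pab|h a b]; [apply: h => W; apply|apply]. Qed.

Definition bi_sup (F : biideal A B -> Prop) : biideal A B :=
  generated (fun a b => exists2 U : biideal A B, F U & U a b).

Lemma bi_order : order _ bi_le.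
Proof.
split=> [U a b//|U V W UV VW a b /UV /VW//|]; exact: biideal_eq.
Qed.

Lemma bi_supP F V : bi_le (bi_sup F) V <-> (forall U, F U -> bi_le U V).
Proof.
rewrite generatedP; split=> [h U FU a b Uab|h a b [U FU]]; last exact: h.
by apply: h; exists U.
Qed.

Definition tensor : suplattice := Suplattice bi_order bi_supP.

Definition pure (a : A) (b : B) : tensor := generated (fun x y => x = a /\ y = b).

Lemma pureP a b (U : tensor) : pure a b ⊑ U <-> bi_rel U a b.
Proof.
rewrite [_ ⊑ _]generatedP; split=> [|h _ _ [-> ->]//]; exact.
Qed.

Lemma pure_supl S b : pure (⋁ S) b = ⋁ (image (pure^~ b) S).
Proof.
apply: eq_ub => U; rewrite sup_imageP pureP bi_supl.
by split=> h s /h /pureP.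
Qed.

Lemma pure_supr a S : pure a (⋁ S) = ⋁ (image (pure a) S).
Proof.
apply: eq_ub => U; rewrite sup_imageP pureP bi_supr.
by split=> h s /h /pureP.
Qed.

Definition pureb : bihom A B tensor := Bihom pure_supl pure_supr.

Lemma tensor_gen (U : tensor) :
  U = ⋁ (image (fun p => pure p.1 p.2) (fun p => bi_rel U p.1 p.2)).
Proof.
apply: eq_ub => V; rewrite sup_imageP; split=> [h [a b] /= Uab|h a b Uab].
  by apply/pureP; apply: h.
by apply/pureP; apply: (h (a, b)).
Qed.

Lemma tensor_ind (P : tensor -> Prop) :
  (forall a b, P (pure a b)) ->
  (forall F, (forall U, F U -> P U) -> P (⋁ F)) -> forall U, P U.
Proof.
by move=> Pp Ps U; rewrite (tensor_gen U); apply: Ps => _ [[a b] _ <-].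
Qed.

Lemma tensor_ext (C : suplattice) (f g : sup_hom tensor C) :
  (forall a b, f (pure a b) = g (pure a b)) -> forall U, f U = g U.
Proof.
move=> e; apply: tensor_ind => // F h.
by rewrite !sh_sup; apply: eq_sup_image.
Qed.

Section Lift.
Variables (C : suplattice) (f : bihom A B C).

Definition below_rel (c : C) : A -> B -> Prop := fun a b => f a b ⊑ c.

Lemma below_supl c S b :
  below_rel c (⋁ S) b <-> (forall a, S a -> below_rel c a b).
Proof. by rewrite /below_rel bh_supl sup_imageP. Qed.

Lemma below_supr c a S :
  below_rel c a (⋁ S) <-> (forall b, S b -> below_rel c a b).
Proof. by rewrite /below_rel bh_supr sup_imageP. Qed.

Definition below (c : C) : tensor := Biideal (below_supl c) (below_supr c).

Definition lift_fun (U : tensor) : C :=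
  ⋁ (fun c => exists a b, bi_rel U a b /\ f a b = c).

Lemma lift_funP U c : lift_fun U ⊑ c <-> U ⊑ below c.
Proof.
rewrite supP; split=> [h a b Uab|h _ [a [b [Uab <-]]]]; last exact: h.
by apply: h; exists a, b.
Qed.

Lemma lift_sup S : lift_fun (⋁ S) = ⋁ (image lift_fun S).
Proof.
apply: eq_ub => c; rewrite lift_funP sup_imageP supP.
by split=> h s /h /lift_funP.
Qed.

Definition lift : sup_hom tensor C := SupHom lift_sup.

Lemma liftE a b : lift (pure a b) = f a b.
Proof. by apply: eq_ub => c; rewrite [_ ⊑ _]lift_funP pureP. Qed.

End Lift.
End Tensor.

Notation "A ⊗ B" := (tensor A B) (at level 40, left associativity).
Notation "a ⊠ b" := (pure a b) (at level 40, left associativity).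

Section TensorMap.
Variables (A A' B B' : suplattice) (f : sup_hom A A') (g : sup_hom B B').

Lemma tmap_supl S b : f (⋁ S) ⊠ g b = ⋁ (image (fun a => f a ⊠ g b) S).
Proof. by rewrite sh_sup pure_supl sup_image_comp. Qed.

Lemma tmap_supr a S : f a ⊠ g (⋁ S) = ⋁ (image (fun b => f a ⊠ g b) S).
Proof. by rewrite sh_sup pure_supr sup_image_comp. Qed.

Definition tmap : sup_hom (A ⊗ B) (A' ⊗ B') := lift (Bihom tmap_supl tmap_supr).

Lemma tmapE a b : tmap (a ⊠ b) = f a ⊠ g b.
Proof. exact: liftE. Qed.

End TensorMap.

Lemma tmap_homl (A A' B B' : suplattice) (F : hom A A' -> Prop) (g : hom B B') :
  tmap (⋁ F) g = ⋁ (image (fun f : hom A A' => tmap f g : hom _ _) F) :> hom _ _.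
Proof.
apply: sup_hom_eq; apply: tensor_ext => a b.
rewrite tmapE !hom_supE pure_supl !sup_image_comp.
by apply: eq_sup_image => f _; rewrite tmapE.
Qed.

Lemma tmap_homr (A A' B B' : suplattice) (f : hom A A') (G : hom B B' -> Prop) :
  tmap f (⋁ G) = ⋁ (image (fun g : hom B B' => tmap f g : hom _ _) G) :> hom _ _.
Proof.
apply: sup_hom_eq; apply: tensor_ext => a b.
rewrite tmapE !hom_supE pure_supr !sup_image_comp.
by apply: eq_sup_image => g _; rewrite tmapE.
Qed.

Lemma tmap_comp (A A' A'' B B' B'' : suplattice)
    (f' : sup_hom A' A'') (f : sup_hom A A') (g' : sup_hom B' B'') (g : sup_hom B B') t :
  tmap f' g' (tmap f g t) = tmap (f' ∘ f) (g' ∘ g) t.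
Proof.
by move: t; apply: (tensor_ext (f := tmap f' g' ∘ tmap f g)) => a b; rewrite !sh_compE !tmapE.
Qed.

Lemma tmap_id (A B : suplattice) (t : A ⊗ B) : tmap (sh_id A) (sh_id B) t = t.
Proof.
by move: t; apply: (tensor_ext (g := sh_id _)) => a b; rewrite tmapE.
Qed.

Definition Omega_le : relation Prop := fun p q => p -> q.

Lemma Omega_order : order Prop Omega_le.
Proof.
split=> [p//|p q r pq qr /pq /qr//|p q pq qp].
by apply: propositional_extensionality.
Qed.

Lemma Omega_supP (S : Prop -> Prop) q :
  Omega_le (exists2 p, S p & p) q <-> (forall p, S p -> Omega_le p q).
Proof. by split=> [h p Sp Pp|h [p Sp]]; [apply: h; exists p|apply: h]. Qed.

Definition Omega : suplattice := Suplattice Omega_order Omega_supP.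

Lemma Omega_leE (p q : Omega) : p ⊑ q <-> (p -> q).
Proof. by []. Qed.

Section Scale.
Variable A : suplattice.

(* The join of {a | p}, which has at most one element. *)
Definition scale (p : Omega) (a : A) : A := ⋁ (fun x => p /\ x = a).

Lemma scaleP p a z : scale p a ⊑ z <-> (p -> a ⊑ z).
Proof.
by rewrite supP; split=> [h Pp|h _ [/h k ->]//]; apply: h.
Qed.

Lemma scale_supl S a : scale (⋁ S) a = ⋁ (image (scale^~ a) S).
Proof.
apply: eq_ub => z; rewrite scaleP sup_imageP.
split=> [h p Sp|h [p Sp Pp]]; first by apply/scaleP => Pp; apply: h; exists p.
by move/scaleP: (h p Sp); apply.
Qed.

Lemma scale_supr p S : scale p (⋁ S) = ⋁ (image (scale p) S).
Proof.
apply: eq_ub => z; rewrite scaleP sup_imageP.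
split=> [h a Sa|h Pp]; first by apply/scaleP => /h /supP; apply.
by apply/supP => a /h /scaleP; apply.
Qed.

Lemma scale_True a : scale True a = a.
Proof. by apply: eq_ub => z; rewrite scaleP; split=> // h; apply: h. Qed.

Definition lunit : sup_hom (Omega ⊗ A) A := lift (Bihom scale_supl scale_supr).

Definition runit : sup_hom (A ⊗ Omega) A :=
  lift (Bihom (bh_fun := fun a p => scale p a)
         (fun S p => scale_supr p S) (fun a S => scale_supl S a)).

Definition lunitV : sup_hom A (Omega ⊗ A) := SupHom (pure_supr (True : Omega)).

Definition runitV : sup_hom A (A ⊗ Omega) :=
  SupHom (fun S => pure_supl S (True : Omega)).

End Scale.

Lemma lunitE (A : suplattice) p (a : A) : lunit A (p ⊠ a) = scale p a.
Proof. exact: liftE. Qed.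

Lemma runitE (A : suplattice) p (a : A) : runit A (a ⊠ p) = scale p a.
Proof. exact: liftE. Qed.

(* The isomorphism Ω ⊗ Ω → Ω, p ⊗ q ↦ p ∧ q. *)
Definition Delta : sup_hom (Omega ⊗ Omega) Omega := lunit Omega.

Lemma DeltaE p q : Delta (p ⊠ q) = (p /\ q).
Proof.
rewrite /Delta lunitE; apply: propositional_extensionality.
by split=> [[r [Pp ->]]|[Pp Pq]]; last by exists q.
Qed.

Section Symmetry.
Variables A B C : suplattice.

Definition swap : sup_hom (A ⊗ B) (B ⊗ A) :=
  lift (Bihom (bh_fun := fun a b => b ⊠ a)
         (fun S b => pure_supr b S) (fun a S => pure_supl S a)).

Lemma swapE a b : swap (a ⊠ b) = b ⊠ a.
Proof. exact: liftE. Qed.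

Lemma assoc_pure_subproof1 (c : C) S b :
  (⋁ S) ⊠ (b ⊠ c) = ⋁ (image (fun a : A => a ⊠ ((b : B) ⊠ c)) S).
Proof. exact: pure_supl. Qed.

Lemma assoc_pure_subproof2 (c : C) (a : A) S :
  a ⊠ ((⋁ S) ⊠ c) = ⋁ (image (fun b : B => a ⊠ (b ⊠ c)) S).
Proof. by rewrite pure_supl pure_supr sup_image_comp. Qed.

Definition assoc_pure (c : C) : sup_hom (A ⊗ B) (A ⊗ (B ⊗ C)) :=
  lift (Bihom (assoc_pure_subproof1 c) (assoc_pure_subproof2 c)).

Lemma assoc_subproof (t : A ⊗ B) S :
  assoc_pure (⋁ S) t = ⋁ (image (fun c => assoc_pure c t) S).
Proof.
pose F : hom (A ⊗ B) (A ⊗ (B ⊗ C)) :=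
  ⋁ (image (assoc_pure : C -> hom (A ⊗ B) (A ⊗ (B ⊗ C))) S).
transitivity (F t); last by rewrite /F hom_supE sup_image_comp.
move: t; apply: tensor_ext => a b.
rewrite liftE hom_supE /bh_fun !pure_supr !sup_image_comp.
by apply: eq_sup_image => c _; rewrite liftE.
Qed.

Definition assoc : sup_hom (A ⊗ B ⊗ C) (A ⊗ (B ⊗ C)) :=
  lift (Bihom (bh_fun := fun t c => assoc_pure c t)
         (fun S c => sh_sup (assoc_pure c) S) assoc_subproof).

Lemma assocE a b c : assoc (a ⊠ b ⊠ c) = a ⊠ (b ⊠ c).
Proof. rewrite /assoc liftE; exact: liftE. Qed.

End Symmetry.

Definition assocV (A B C : suplattice) : sup_hom (A ⊗ (B ⊗ C)) (A ⊗ B ⊗ C) :=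
  swap C (A ⊗ B) ∘ tmap (sh_id C) (swap B A) ∘ assoc C B A
    ∘ tmap (swap B C) (sh_id A) ∘ swap A (B ⊗ C).

Lemma assocVE (A B C : suplattice) (a : A) (b : B) (c : C) :
  assocV A B C (a ⊠ (b ⊠ c)) = a ⊠ b ⊠ c.
Proof.
by rewrite /assocV !sh_compE swapE tmapE swapE assocE tmapE swapE swapE.
Qed.

Lemma tensor_ext3 (A B C D : suplattice) (f g : sup_hom (A ⊗ B ⊗ C) D) :
  (forall a b c, f (a ⊠ b ⊠ c) = g (a ⊠ b ⊠ c)) -> forall t, f t = g t.
Proof.
move=> e; apply: tensor_ext => t c; move: t; apply: tensor_ind => // F h.
by rewrite pure_supl !sh_sup; apply: eq_sup_image => _ [t Ft <-]; apply: h.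
Qed.

Record duality (A B : suplattice)
    (eta : sup_hom Omega (B ⊗ A)) (eps : sup_hom (A ⊗ B) Omega) : Prop := Duality {
  duality_l : forall a,
    (lunit A ∘ tmap eps (sh_id A) ∘ assocV A B A ∘ tmap (sh_id A) eta ∘ runitV A) a = a;
  duality_r : forall b,
    (runit B ∘ tmap (sh_id B) eps ∘ assoc B A B ∘ tmap eta (sh_id B) ∘ lunitV B) b = b }.

Definition dualisable (A : suplattice) : Prop :=
  exists (B : suplattice) (eta : sup_hom Omega (B ⊗ A)) (eps : sup_hom (A ⊗ B) Omega),
    duality eta eps.

Record quantale : Type := Quantale {
  q_sl :> suplattice;
  qmul : q_sl -> q_sl -> q_sl;
  qone : q_sl;
  qmulA : forall a b c, qmul a (qmul b c) = qmul (qmul a b) c;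
  qmulC : forall a b, qmul a b = qmul b a;
  qmul1 : forall a, qmul qone a = a;
  qmul_sup : forall a S, qmul a (⋁ S) = ⋁ (image (qmul a) S) }.

Arguments qone {q}.

Notation "x · y" := (qmul x y) (at level 40, left associativity).

Record quantale_hom (Q Q' : quantale) : Type := QuantaleHom {
  qh_sup_hom :> sup_hom Q Q';
  qh_mul : forall a b, qh_sup_hom (a · b) = qh_sup_hom a · qh_sup_hom b;
  qh_one : qh_sup_hom qone = qone }.

Lemma quantale_hom_eq (Q Q' : quantale) (f g : quantale_hom Q Q') : f =1 g -> f = g.
Proof.
case: f g => [f f1 f2] [g g1 g2] /= /(@sup_hom_eq _ _ f g) e.
by case: _ / e g1 g2 => g1 g2; congr QuantaleHom; apply: proof_irrelevance.
Qed.

Lemma qh_id_mul (Q : quantale) (a b : Q) : sh_id Q (a · b) = sh_id Q a · sh_id Q b.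
Proof. by []. Qed.
Lemma qh_id_one (Q : quantale) : sh_id Q qone = qone.
Proof. by []. Qed.
Definition qh_id (Q : quantale) : quantale_hom Q Q :=
  QuantaleHom (@qh_id_mul Q) (qh_id_one Q).

Lemma qh_comp_mul (P Q R : quantale) (g : quantale_hom Q R) (f : quantale_hom P Q) a b :
  (g ∘ f) (a · b) = (g ∘ f) a · (g ∘ f) b.
Proof. by rewrite /= !qh_mul. Qed.
Lemma qh_comp_one (P Q R : quantale) (g : quantale_hom Q R) (f : quantale_hom P Q) :
  (g ∘ f) qone = qone.
Proof. by rewrite /= !qh_one. Qed.
Definition qh_comp (P Q R : quantale) (g : quantale_hom Q R) (f : quantale_hom P Q) :
  quantale_hom P R := QuantaleHom (@qh_comp_mul P Q R g f) (qh_comp_one g f).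

Record two_sided : Type := TwoSided {
  ts_quantale :> quantale;
  ts_top : qone = top ts_quantale }.

Record frame : Type := Frame {
  fr_two_sided :> two_sided;
  fr_idem : forall a : fr_two_sided, a · a = a }.

Section QuantaleTheory.
Variable Q : quantale.
Implicit Types a b : Q.

Lemma qmulr1 a : a · qone = a.
Proof. by rewrite qmulC qmul1. Qed.

Lemma qmul_supl S b : (⋁ S) · b = ⋁ (image (fun a : Q => a · b) S).
Proof. by rewrite qmulC qmul_sup; apply: eq_sup_image => s _; apply: qmulC. Qed.

Definition qmulb : bihom Q Q Q := Bihom qmul_supl (@qmul_sup Q).

Definition qmulh a : sup_hom Q Q := SupHom (@qmul_sup Q a).

Lemma qmulh_sup S : qmulh (⋁ S) = ⋁ (image (qmulh : Q -> hom Q Q) S) :> hom Q Q.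
Proof. by apply: sup_hom_eq => b /=; rewrite qmul_supl sup_image_comp. Qed.

Lemma qmul_mono a a' b b' : a ⊑ a' -> b ⊑ b' -> a · b ⊑ a' · b'.
Proof.
move=> ha hb; apply: (le_trans (y := a · b')); first exact: (sh_mono (qmulh a)).
by rewrite (qmulC a) (qmulC a'); exact: (sh_mono (qmulh b')).
Qed.

Lemma qmulACA a b c d : (a · b) · (c · d) = (a · c) · (b · d).
Proof. by rewrite -!qmulA (qmulA b) (qmulC b) -qmulA. Qed.

Lemma qmul_topA a : (a · top Q) · top Q = a · top Q.
Proof.
rewrite -qmulA; congr (_ · _); apply: le_anti; first exact: le_top.
rewrite -{1}(qmul1 (top Q)); apply: qmul_mono; [exact: le_top|exact: le_refl].
Qed.

End QuantaleTheory.

Lemma Omega_mulA (p q r : Omega) : (p /\ (q /\ r)) = ((p /\ q) /\ r).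
Proof. by apply: propositional_extensionality; split=> [[? []]|[[]]]. Qed.
Lemma Omega_mulC (p q : Omega) : (p /\ q) = (q /\ p).
Proof. by apply: propositional_extensionality; split=> -[]. Qed.
Lemma Omega_mul1 (p : Omega) : (True /\ p) = p.
Proof. by apply: propositional_extensionality; split=> [[]|]. Qed.
Lemma Omega_mul_sup (p : Omega) (S : Omega -> Prop) :
  (p /\ ⋁ S) = ⋁ (image (fun q : Omega => p /\ q : Omega) S).
Proof.
apply: propositional_extensionality; split=> [[Pp [q Sq Pq]]|[_ [q Sq <-] [Pp Pq]]].
  by exists (p /\ q) => //; exists q.
by split=> //; exists q.
Qed.

Definition Omega_quantale : quantale :=
  Quantale (q_sl := Omega) Omega_mulA Omega_mulC Omega_mul1 Omega_mul_sup.

Lemma Omega_top : qone = top Omega_quantale.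
Proof.
by apply: propositional_extensionality; split=> // _; exists True.
Qed.

Definition Omega_two_sided : two_sided := TwoSided Omega_top.

Lemma Omega_idem (p : Omega_two_sided) : p · p = p.
Proof. by apply: propositional_extensionality; split=> [[]|]. Qed.

Definition Omega_frame : frame := Frame Omega_idem.

Section Initial.
Variable Q : quantale.

Definition initial_sup_hom : sup_hom Omega Q :=
  SupHom (fun S => scale_supl S (qone : Q)).

Lemma initial_mul (p q : Omega_quantale) :
  initial_sup_hom (p · q) = initial_sup_hom p · initial_sup_hom q.
Proof.
apply: eq_ub => z; rewrite /= scaleP qmul_supl sup_imageP; split.
  move=> h _ [Pp ->]; rewrite qmul1; apply/scaleP => Pq; exact: h.
move=> h [Pp Pq]; have := h _ (conj Pp erefl); rewrite qmul1 => /scaleP; exact.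
Qed.

Lemma initial_one : initial_sup_hom (@qone Omega_quantale) = qone.
Proof. exact: scale_True. Qed.

Definition initial : quantale_hom Omega_quantale Q :=
  QuantaleHom initial_mul initial_one.

End Initial.

Section TensorQuantale.
Variables Q Q' : quantale.

Lemma tmul_supl S (b : Q') :
  tmap (qmulh (⋁ S)) (qmulh b) =
  ⋁ (image (fun a : Q => tmap (qmulh a) (qmulh b) : hom _ _) S) :> hom _ _.
Proof. by rewrite qmulh_sup tmap_homl sup_image_comp. Qed.

Lemma tmul_supr (a : Q) S :
  tmap (qmulh a) (qmulh (⋁ S)) =
  ⋁ (image (fun b : Q' => tmap (qmulh a) (qmulh b) : hom _ _) S) :> hom _ _.
Proof. by rewrite qmulh_sup tmap_homr sup_image_comp. Qed.

Definition tmul_hom : sup_hom (Q ⊗ Q') (hom (Q ⊗ Q') (Q ⊗ Q')) :=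
  lift (Bihom tmul_supl tmul_supr).

Definition tmul (t u : Q ⊗ Q') : Q ⊗ Q' := (tmul_hom t : sup_hom _ _) u.

Lemma tmulE a b c d : tmul (a ⊠ b) (c ⊠ d) = (a · c) ⊠ (b · d).
Proof. rewrite /tmul /tmul_hom liftE; exact: tmapE. Qed.

Lemma tmul_sup t S : tmul t (⋁ S) = ⋁ (image (tmul t) S).
Proof. exact: sh_sup. Qed.

Lemma tmul_sup_l S u : tmul (⋁ S) u = ⋁ (image (tmul^~ u) S).
Proof. by rewrite /tmul sh_sup hom_supE sup_image_comp. Qed.

Lemma tmulC t u : tmul t u = tmul u t.
Proof.
move: t; apply: tensor_ind => [a b|F h]; last first.
  by rewrite tmul_sup tmul_sup_l; apply: eq_sup_image.
move: u; apply: tensor_ind => [c d|F h]; last first.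
  by rewrite tmul_sup tmul_sup_l; apply: eq_sup_image.
by rewrite !tmulE (qmulC a) (qmulC b).
Qed.

Lemma tmulA t u v : tmul t (tmul u v) = tmul (tmul t u) v.
Proof.
move: t; apply: tensor_ind => [a b|F h]; last first.
  by rewrite !tmul_sup_l sup_image_comp; apply: eq_sup_image.
move: u; apply: tensor_ind => [c d|F h]; last first.
  rewrite !(tmul_sup, tmul_sup_l) !sup_image_comp.
  by apply: eq_sup_image.
move: v; apply: tensor_ind => [e f|F h]; last first.
  by rewrite !tmul_sup sup_image_comp; apply: eq_sup_image.
by rewrite !tmulE !qmulA.
Qed.

Lemma tmul1 t : tmul (qone ⊠ qone) t = t.
Proof.
move: t; apply: tensor_ind => [a b|F h]; first by rewrite tmulE !qmul1.
by rewrite tmul_sup (eq_sup_image (g := sh_id _) h) -sh_sup.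
Qed.

Definition tensor_quantale : quantale := Quantale tmulA tmulC tmul1 tmul_sup.

Lemma pure_mul (a c : Q) (b d : Q') :
  ((a ⊠ b : tensor_quantale) · (c ⊠ d : tensor_quantale)) = (a · c) ⊠ (b · d).
Proof. exact: tmulE. Qed.

Lemma inl_mul (a b : Q) :
  (a · b) ⊠ qone = (a ⊠ qone : tensor_quantale) · (b ⊠ qone : tensor_quantale).
Proof. by rewrite pure_mul qmul1. Qed.

Lemma inr_mul (a b : Q') :
  qone ⊠ (a · b) = (qone ⊠ a : tensor_quantale) · (qone ⊠ b : tensor_quantale).
Proof. by rewrite pure_mul qmul1. Qed.

Definition tinl : quantale_hom Q tensor_quantale :=
  @QuantaleHom Q tensor_quantale
    (SupHom (fun S => pure_supl S (qone : Q'))) inl_mul erefl.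

Definition tinr : quantale_hom Q' tensor_quantale :=
  @QuantaleHom Q' tensor_quantale (SupHom (pure_supr (qone : Q))) inr_mul erefl.

Section Copairing.
Variables (P : quantale) (f : quantale_hom Q P) (g : quantale_hom Q' P).

Lemma copair_supl S b : f (⋁ S) · g b = ⋁ (image (fun a => f a · g b) S).
Proof. by rewrite sh_sup qmul_supl sup_image_comp. Qed.

Lemma copair_supr a S : f a · g (⋁ S) = ⋁ (image (fun b => f a · g b) S).
Proof. by rewrite sh_sup qmul_sup sup_image_comp. Qed.

Definition copair_sup_hom : sup_hom tensor_quantale P :=
  lift (Bihom copair_supl copair_supr).

Lemma copair_mul (t u : tensor_quantale) :
  copair_sup_hom (t · u) = copair_sup_hom t · copair_sup_hom u.
Proof.
move: t; apply: tensor_ind => [a b|F h]; last first.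
  rewrite (@qmul_supl tensor_quantale F) !(sh_sup copair_sup_hom) qmul_supl.
  rewrite !sup_image_comp.
  by apply: eq_sup_image.
move: u; apply: tensor_ind => [c d|F h]; last first.
  rewrite (@qmul_sup tensor_quantale _ F) !(sh_sup copair_sup_hom) qmul_sup.
  rewrite !sup_image_comp.
  by apply: eq_sup_image.
by rewrite pure_mul !liftE /= !qh_mul qmulACA.
Qed.

Lemma copair_one : copair_sup_hom (@qone tensor_quantale) = qone.
Proof. by rewrite liftE /= !qh_one qmul1. Qed.

Definition copair : quantale_hom tensor_quantale P := QuantaleHom copair_mul copair_one.

End Copairing.
End TensorQuantale.

Notation "Q ⊕ Q'" := (tensor_quantale Q Q') (at level 50, left associativity).

Section TensorQuantaleHom.
Variables (P P' Q Q' : quantale) (f : quantale_hom P P') (g : quantale_hom Q Q').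

Lemma qtmap_mul (t u : P ⊕ Q) :
  tmap f g (t · u) = (tmap f g t : P' ⊕ Q') · (tmap f g u : P' ⊕ Q').
Proof.
move: t; apply: tensor_ind => [a b|F h]; last first.
  rewrite (@qmul_supl (P ⊕ Q) F) !(sh_sup (tmap f g)).
  rewrite (@qmul_supl (P' ⊕ Q') (image (tmap f g) F)) !sup_image_comp.
  by apply: eq_sup_image.
move: u; apply: tensor_ind => [c d|F h]; last first.
  rewrite (@qmul_sup (P ⊕ Q) _ F) !(sh_sup (tmap f g)).
  rewrite (@qmul_sup (P' ⊕ Q') _ (image (tmap f g) F)) !sup_image_comp.
  by apply: eq_sup_image.
by rewrite pure_mul !tmapE pure_mul !qh_mul.
Qed.

Lemma qtmap_one : tmap f g (qone : P ⊕ Q) = (qone : P' ⊕ Q').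
Proof. by rewrite tmapE !qh_one. Qed.

Definition qtmap : quantale_hom (P ⊕ Q) (P' ⊕ Q') :=
  @QuantaleHom (P ⊕ Q) (P' ⊕ Q') (tmap f g) qtmap_mul qtmap_one.

End TensorQuantaleHom.

Record nucleus (Q : quantale) : Type := Nucleus {
  nu_fun :> Q -> Q;
  nu_mono : forall x y, x ⊑ y -> nu_fun x ⊑ nu_fun y;
  nu_infl : forall x, x ⊑ nu_fun x;
  nu_idem : forall x, nu_fun (nu_fun x) ⊑ nu_fun x;
  nu_mul : forall x y, nu_fun x · nu_fun y ⊑ nu_fun (x · y) }.

Section Quotient.
Variables (Q : quantale) (nu : nucleus Q).

Definition quot_sort : Type := {x : Q | nu x = x}.

Lemma quot_eq (x y : quot_sort) : sval x = sval y -> x = y.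
Proof.
case: x y => [x hx] [y hy] /= e; case: _ / e hy => hy.
by congr exist; apply: proof_irrelevance.
Qed.

Lemma nu_nu x : nu (nu x) = nu x.
Proof. by apply: le_anti; [apply: nu_idem|apply: nu_infl]. Qed.

Definition quot_proj (x : Q) : quot_sort := exist _ (nu x) (nu_nu x).

Lemma nu_le x y : nu x ⊑ nu y <-> x ⊑ nu y.
Proof.
split=> [|h]; first by apply: le_trans; apply: nu_infl.
by rewrite -(nu_nu y); apply: nu_mono.
Qed.

Lemma nu_mulr x y : nu (x · nu y) = nu (x · y).
Proof.
apply: le_anti; apply/nu_le.
  apply: le_trans (nu_mul _ _ _); apply: qmul_mono (nu_infl _ _) (le_refl _).
by apply: le_trans (nu_infl _ _); apply: qmul_mono (le_refl _) (nu_infl _ _).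
Qed.

Lemma nu_mull x y : nu (nu x · y) = nu (x · y).
Proof. by rewrite qmulC nu_mulr qmulC. Qed.

Definition quot_le : relation quot_sort := fun x y => sval x ⊑ sval y.
Definition quot_sup (S : quot_sort -> Prop) : quot_sort :=
  quot_proj (⋁ (image sval S)).

Lemma quot_order : order _ quot_le.
Proof.
split=> [x|x y z|x y xy yx]; [exact: le_refl|exact: le_trans|].
by apply: quot_eq; apply: le_anti.
Qed.

Lemma quot_supP S x : quot_le (quot_sup S) x <-> (forall s, S s -> quot_le s x).
Proof.
by case: x => x hx; rewrite /quot_le /= -{1}hx nu_le hx sup_imageP.
Qed.

Definition quot_suplattice : suplattice := Suplattice quot_order quot_supP.

Definition quot_mul (x y : quot_suplattice) : quot_suplattice :=
  quot_proj (sval x · sval y).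

Lemma quot_mulA x y z : quot_mul x (quot_mul y z) = quot_mul (quot_mul x y) z.
Proof. by apply: quot_eq; rewrite /= nu_mulr nu_mull qmulA. Qed.

Lemma quot_mulC x y : quot_mul x y = quot_mul y x.
Proof. by apply: quot_eq; rewrite /= qmulC. Qed.

Lemma quot_mul1 x : quot_mul (quot_proj qone) x = x.
Proof. by apply: quot_eq; rewrite /= nu_mull qmul1 (svalP x). Qed.

Lemma quot_proj_sup S :
  (quot_proj (⋁ S) : quot_suplattice) = ⋁ (image (quot_proj : Q -> quot_suplattice) S).
Proof.
apply: (@eq_ub quot_suplattice) => z; rewrite sup_imageP; case: z => z hz.
rewrite /= /quot_le /= -hz nu_le supP; split=> h s /h; first by move/nu_le.
by move/nu_le.
Qed.

Lemma quot_mul_sup x S : quot_mul x (⋁ S) = ⋁ (image (quot_mul x) S).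
Proof.
rewrite {1}/quot_mul; transitivity (quot_proj (sval x · ⋁ (image sval S))).
  by apply: quot_eq; rewrite /= nu_mulr.
by rewrite qmul_sup quot_proj_sup !sup_image_comp.
Qed.

Definition quot : quantale := Quantale quot_mulA quot_mulC quot_mul1 quot_mul_sup.

Lemma quot_map_mul (x y : Q) :
  (quot_proj (x · y) : quot) = (quot_proj x : quot) · (quot_proj y : quot).
Proof. by apply: quot_eq; rewrite /= nu_mulr nu_mull. Qed.

Definition quot_map : quantale_hom Q quot :=
  @QuantaleHom Q quot (SupHom quot_proj_sup) quot_map_mul erefl.

Section Factor.
Variables (P : quantale) (f : quantale_hom Q P).
Hypothesis f_nu : forall x, f (nu x) = f x.

Lemma factor_sup S : f (sval (⋁ S : quot)) = ⋁ (image (fun x : quot => f (sval x)) S).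
Proof. by rewrite /= f_nu sh_sup sup_image_comp. Qed.

Lemma factor_mul (x y : quot) : f (sval (x · y)) = f (sval x) · f (sval y).
Proof. by rewrite /= f_nu qh_mul. Qed.

Lemma factor_one : f (sval (qone : quot)) = qone.
Proof. by rewrite /= f_nu qh_one. Qed.

Definition quot_factor : quantale_hom quot P :=
  @QuantaleHom quot P (SupHom factor_sup) factor_mul factor_one.

Lemma quot_factorE x : quot_factor (quot_map x) = f x.
Proof. exact: f_nu. Qed.

End Factor.
End Quotient.

Record congruence (Q : quantale) (E : relation Q) : Prop := Congruence {
  cong_equiv : equivalence Q E;
  cong_mul : forall a a' b b', E a a' -> E b b' -> E (a · b) (a' · b');
  cong_sup : forall S : Q -> Q -> Prop, (forall x y, S x y -> E x y) ->
    E (⋁ (fun x => exists y, S x y)) (⋁ (fun y => exists x, S x y)) }.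

Section CongruenceQuotient.
Variables (Q : quantale) (r : relation Q).

Definition generated_congruence : relation Q :=
  fun a b => forall E : relation Q,
    congruence E -> (forall x y, r x y -> E x y) -> E a b.

Local Notation "x ~ y" := (generated_congruence x y) (at level 70).

Lemma generated_congruenceP : congruence generated_congruence.
Proof.
split; first split.
- by move=> x E [[]].
- move=> x y z xy yz E hE rE; case: (hE) => -[_ t _] _ _.
  by apply: (t _ y); [apply: xy|apply: yz].
- by move=> x y xy E hE rE; case: (hE) => -[_ _ s] _ _; apply: s; apply: xy.
- move=> a a' b b' h k E hE rE; case: (hE) => _ m _.
  by apply: m; [apply: h|apply: k].
- move=> S h E hE rE; case: (hE) => _ _ s.
  by apply: s => x y /h; apply.
Qed.

(* The largest element of the congruence class of [x]. The quotient of [Q] by the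
   congruence is realised on the largest elements of the classes: these are the
   fixed points of the nucleus [cong_nucleus] below. *)
Definition class_top (x : Q) : Q := ⋁ (fun y => y ~ x).

Lemma cong_refl x : x ~ x.
Proof. by case: generated_congruenceP => -[]. Qed.

Lemma cong_sym x y : x ~ y -> y ~ x.
Proof. by case: generated_congruenceP => -[_ _ h] _ _; apply: h. Qed.

Lemma cong_trans y x z : x ~ y -> y ~ z -> x ~ z.
Proof. by case: generated_congruenceP => -[_ h _] _ _; apply: h. Qed.

Lemma class_top_cong x : class_top x ~ x.
Proof.
case: generated_congruenceP => _ _ /(_ (fun y z => y ~ x /\ z = x)) h.
have -> : class_top x = ⋁ (fun y => exists z, y ~ x /\ z = x).
  by apply: eq_sup => y; split=> [yx|[z []//]]; exists x.
have {3}-> : x = ⋁ (fun z => exists y, y ~ x /\ z = x).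
  rewrite -{1}(sup1 x); apply: eq_sup => z; split=> [->|[y []//]].
  by exists x; split=> //; apply: cong_refl.
by apply: h => y z [yx ->].
Qed.

Lemma class_top_max x y : y ~ x -> y ⊑ class_top x.
Proof. by move=> h; apply: sup_ub. Qed.

Lemma cong_join x x' y y' : x ~ x' -> y ~ y' -> join x y ~ join x' y'.
Proof.
move=> hx hy; case: generated_congruenceP => _ _.
move=> /(_ (fun a b => a = x /\ b = x' \/ a = y /\ b = y')) h.
have -> : join x y = ⋁ (fun a => exists b, a = x /\ b = x' \/ a = y /\ b = y').
  apply: eq_sup => a; split=> [[->|->]|[b [[-> _]|[-> _]]]];
    [by exists x'; left|by exists y'; right|by left|by right].
have -> : join x' y' = ⋁ (fun b => exists a, a = x /\ b = x' \/ a = y /\ b = y').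
  apply: eq_sup => b; split=> [[->|->]|[a [[_ ->]|[_ ->]]]];
    [by exists x; left|by exists y; right|by left|by right].
by apply: h => a b [] [-> ->].
Qed.

Lemma class_top_mono x y : x ⊑ y -> class_top x ⊑ class_top y.
Proof.
move=> xy; have /class_top_max : join (class_top x) y ~ y.
  by rewrite -{2}(join_le xy); apply: cong_join (class_top_cong _) (cong_refl _).
by move/joinP => [].
Qed.

Lemma class_top_infl x : x ⊑ class_top x.
Proof. by apply: class_top_max; apply: cong_refl. Qed.

Lemma class_top_idem x : class_top (class_top x) ⊑ class_top x.
Proof.
apply: class_top_max.
exact: cong_trans (class_top_cong _) (class_top_cong _).
Qed.

Lemma class_top_mul x y : class_top x · class_top y ⊑ class_top (x · y).
Proof.
apply: class_top_max; case: generated_congruenceP => _ h _.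
by apply: h; apply: class_top_cong.
Qed.

Definition cong_nucleus : nucleus Q :=
  Nucleus class_top_mono class_top_infl class_top_idem class_top_mul.

Lemma class_top_eq x y : x ~ y -> class_top x = class_top y.
Proof.
move=> xy; apply: le_anti; apply: class_top_max.
  exact: cong_trans (class_top_cong _) xy.
exact: cong_trans (class_top_cong _) (cong_sym xy).
Qed.

Lemma class_top_gen x y : r x y -> class_top x = class_top y.
Proof. by move=> h; apply: class_top_eq => E _; apply. Qed.

End CongruenceQuotient.

Definition positive (A : suplattice) (a : A) : Prop :=
  forall I : A -> Prop, a ⊑ ⋁ I -> exists i, I i.

(* A locale is represented by its frame of opens. *)
Definition overt (A : frame) : Prop :=
  exists2 B : A -> Prop, (forall b, B b -> positive b) &
    forall a : A, a = ⋁ (fun b => B b /\ b ⊑ a).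

(* The semiring axioms are written in the opposite of the category of locales:
   for instance, [ls_distr] says that x(y + z) and xy + xz are equal as locale
   maps R × (R × R) → R, and [ls_mul0] that 0x = 0. *)
Record localic_semiring : Type := LocalicSemiring {
  opens :> frame;
  ls_zero : quantale_hom opens Omega_frame;
  ls_one : quantale_hom opens Omega_frame;
  ls_add : quantale_hom opens (opens ⊕ opens);
  ls_mul : quantale_hom opens (opens ⊕ opens);
  ls_addA : forall a,
    assoc opens opens opens (tmap ls_add (qh_id opens) (ls_add a))
      = tmap (qh_id opens) ls_add (ls_add a);
  ls_addC : forall a, swap opens opens (ls_add a) = ls_add a;
  ls_add0 : forall a, lunit opens (tmap ls_zero (qh_id opens) (ls_add a)) = a;
  ls_mulA : forall a,
    assoc opens opens opens (tmap ls_mul (qh_id opens) (ls_mul a))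
      = tmap (qh_id opens) ls_mul (ls_mul a);
  ls_mulC : forall a, swap opens opens (ls_mul a) = ls_mul a;
  ls_mul1 : forall a, lunit opens (tmap ls_one (qh_id opens) (ls_mul a)) = a;
  ls_distr : forall a,
    tmap (qh_id opens) ls_add (ls_mul a)
      = copair (qh_comp (qtmap (qh_id opens) (tinl opens opens)) ls_mul)
               (qh_comp (qtmap (qh_id opens) (tinr opens opens)) ls_mul)
               (ls_add a);
  ls_mul0 : forall a,
    lunit opens (tmap ls_zero (qh_id opens) (ls_mul a)) = initial opens (ls_zero a) }.

Section OPAI.
Variable R : localic_semiring.

(* OPAI stands for open prime anti-ideal. *)
Record is_OPAI (Q : two_sided) (u : Q ⊕ R) : Prop := IsOPAI {
  opai_zero : qtmap (qh_id Q) (ls_zero R) u = bot (Q ⊕ Omega_frame);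
  opai_one : qtmap (qh_id Q) (ls_one R) u = (qone : Q ⊕ Omega_frame);
  opai_add : qtmap (qh_id Q) (ls_add R) u
    ⊑ join (qtmap (qh_id Q) (tinl R R) u) (qtmap (qh_id Q) (tinr R R) u);
  opai_mul : qtmap (qh_id Q) (ls_mul R) u
    = qtmap (qh_id Q) (tinl R R) u · qtmap (qh_id Q) (tinr R R) u }.

Definition OPAI_obj (Q : two_sided) : Type := {u : Q ⊕ R | is_OPAI u}.

Lemma OPAI_obj_eq (Q : two_sided) (u v : OPAI_obj Q) : sval u = sval v -> u = v.
Proof.
case: u v => [u hu] [v hv] /= e; case: _ / e hv => hv.
by congr exist; apply: proof_irrelevance.
Qed.

Lemma qtmap_exchange (Q Q' : two_sided) (P : quantale) (g : quantale_hom Q Q')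
    (f : quantale_hom R P) (u : Q ⊕ R) :
  qtmap (qh_id Q') f (qtmap g (qh_id R) u) = qtmap g (qh_id P) (qtmap (qh_id Q) f u).
Proof.
rewrite [LHS](tmap_comp (qh_id Q') g f (qh_id R) u).
rewrite [RHS](tmap_comp g (qh_id Q) (qh_id P) f u).
by congr (sh_fun (tmap _ _) _); apply: sup_hom_eq.
Qed.

Lemma sh_join (A B : suplattice) (f : sup_hom A B) x y :
  f (join x y) = join (f x) (f y).
Proof.
apply: eq_ub => z; rewrite sh_sup sup_imageP joinP; split=> [h|[hx hy] s [->|->]] //.
by split; apply: h; [left|right].
Qed.

Lemma sh_bot (A B : suplattice) (f : sup_hom A B) : f (bot A) = bot B.
Proof.
by rewrite sh_sup; apply: le_anti; [apply/sup_imageP|apply: bot_le].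
Qed.

Lemma is_OPAI_map (Q Q' : two_sided) (g : quantale_hom Q Q') (u : Q ⊕ R) :
  is_OPAI u -> is_OPAI (qtmap g (qh_id R) u).
Proof.
move=> [u0 u1 ua um]; split; rewrite !qtmap_exchange.
- by rewrite u0 sh_bot.
- by rewrite u1 qh_one.
- by rewrite -sh_join; apply: sh_mono.
- by rewrite um qh_mul.
Qed.

Definition OPAI_map (Q Q' : two_sided) (g : quantale_hom Q Q') (u : OPAI_obj Q) :
  OPAI_obj Q' := exist _ (qtmap g (qh_id R) (sval u)) (is_OPAI_map g (svalP u)).

End OPAI.

(* Functors from the category of two-sided quantales and quantale homomorphisms
   to the category of sets. *)
Record set_functor : Type := SetFunctor {
  sf_obj :> two_sided -> Type;
  sf_map : forall Q Q' : two_sided, quantale_hom Q Q' -> sf_obj Q -> sf_obj Q';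
  sf_id : forall (Q : two_sided) x, sf_map (qh_id Q) x = x;
  sf_comp : forall (P Q Q' : two_sided) (g : quantale_hom Q Q') (f : quantale_hom P Q) x,
    sf_map (qh_comp g f) x = sf_map g (sf_map f x) }.

(* [F] is represented by [A] with universal element [x]: there is a natural
   isomorphism from Hom(A, -) to [F], and it sends the identity of [A] to [x]. *)
Definition represents (F : set_functor) (A : two_sided) (x : F A) : Prop :=
  exists alpha : forall Q : two_sided, quantale_hom A Q -> F Q,
    [/\ forall (Q Q' : two_sided) (g : quantale_hom Q Q') (f : quantale_hom A Q),
          alpha Q' (qh_comp g f) = sf_map g (alpha Q f),
        forall Q : two_sided, bijective (alpha Q)
      & alpha A (qh_id A) = x].

Section OPAIFunctor.
Variable R : localic_semiring.

Lemma OPAI_id (Q : two_sided) (u : OPAI_obj R Q) : OPAI_map (qh_id Q) u = u.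
Proof. by apply: OPAI_obj_eq; apply: tmap_id. Qed.

Lemma OPAI_comp (P Q Q' : two_sided) (g : quantale_hom Q Q') (f : quantale_hom P Q)
    (u : OPAI_obj R P) : OPAI_map (qh_comp g f) u = OPAI_map g (OPAI_map f u).
Proof.
apply: OPAI_obj_eq; rewrite [RHS](tmap_comp g f (qh_id R) (qh_id R) (sval u)).
by congr (sh_fun (tmap _ _) _); apply: sup_hom_eq.
Qed.

Definition OPAI : set_functor := SetFunctor OPAI_id OPAI_comp.

End OPAIFunctor.

Section Saturated.
Variable R : localic_semiring.

Definition saturated (s : R) : Prop := ls_mul R s ⊑ tinl R R s.

Definition sat_sort : Type := {s : R | saturated s}.
Definition sat_le : relation sat_sort := fun s t => sval s ⊑ sval t.

Lemma saturated_sup (S : sat_sort -> Prop) : saturated (⋁ (image sval S)).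
Proof.
rewrite /saturated !sh_sup !sup_image_comp; apply/sup_imageP => s Ss.
by apply: le_trans (svalP s) _; apply: sup_ub; exists s.
Qed.

Definition sat_sup (S : sat_sort -> Prop) : sat_sort :=
  exist _ (⋁ (image sval S)) (@saturated_sup S).

Lemma sat_order : order _ sat_le.
Proof.
split=> [x|x y z|[x hx] [y hy] xy yx]; [exact: le_refl|exact: le_trans|].
have e : x = y by apply: le_anti.
case: _ / e hy {xy yx} => hy; congr exist; exact: proof_irrelevance.
Qed.

Lemma sat_supP S x : sat_le (sat_sup S) x <-> (forall s, S s -> sat_le s x).
Proof. by rewrite /sat_le /= sup_imageP. Qed.

Definition saturated_opens : suplattice := Suplattice sat_order sat_supP.

Definition kappa : sup_hom saturated_opens R :=
  @SupHom saturated_opens R (fun s => sval s) (fun S => erefl).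

End Saturated.

Section Ideals.
Variable R : localic_semiring.

Definition convolution (mu : sup_hom R (R ⊗ R)) (f g : hom R Omega) : hom R Omega :=
  Delta ∘ tmap f g ∘ mu.

Section ConvolutionTheory.
Variable mu : sup_hom R (R ⊗ R).

Lemma convolutionC : (forall a, swap R R (mu a) = mu a) ->
  forall f g, convolution mu f g = convolution mu g f.
Proof.
move=> muC f g; apply: sup_hom_eq => a; rewrite /convolution !sh_compE; rewrite -{1}muC.
move: (mu a); apply: (tensor_ext (f := Delta ∘ tmap f g ∘ swap R R)
  (g := Delta ∘ tmap g f)) => b c.
by rewrite !sh_compE swapE !tmapE !DeltaE Omega_mulC.
Qed.

Lemma convolutionA :
  (forall a, assoc R R R (tmap mu (qh_id R) (mu a)) = tmap (qh_id R) mu (mu a)) ->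
  forall f g h, convolution mu f (convolution mu g h)
              = convolution mu (convolution mu f g) h.
Proof.
move=> muA f g h; apply: sup_hom_eq => a; rewrite /convolution !sh_compE.
transitivity (Delta (tmap f (Delta ∘ tmap g h) (tmap (qh_id R) mu (mu a)))).
  by rewrite tmap_comp; congr (Delta (sh_fun (tmap _ _) _)); apply: sup_hom_eq.
transitivity (Delta (tmap (Delta ∘ tmap f g) h (tmap mu (qh_id R) (mu a)))); last first.
  by rewrite tmap_comp; congr (Delta (sh_fun (tmap _ _) _)); apply: sup_hom_eq.
rewrite -muA; move: (tmap mu _ _).
apply: (tensor_ext3 (f := Delta ∘ tmap f (Delta ∘ tmap g h) ∘ assoc R R R)
  (g := Delta ∘ tmap (Delta ∘ tmap f g) h)) => b c d.
by rewrite !sh_compE assocE !tmapE !sh_compE !tmapE !DeltaE Omega_mulA.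
Qed.

Lemma convolution1 (e : hom R Omega) :
  (forall a, lunit R (tmap e (qh_id R) (mu a)) = a) ->
  forall f, convolution mu e f = f.
Proof.
move=> mu1 f; apply: sup_hom_eq => a; rewrite /convolution !sh_compE; rewrite -{2}(mu1 a).
move: (mu a); apply: (tensor_ext (f := Delta ∘ tmap e f)
  (g := f ∘ lunit R ∘ tmap e (qh_id R))) => b c.
rewrite !sh_compE !tmapE lunitE /Delta lunitE /scale sh_sup.
apply: eq_ub => z; rewrite sup_imageP supP; split=> [h _ [eb ->]|h _ [eb ->]].
  exact: h.
by apply: h.
Qed.

Lemma convolution_sup f S :
  convolution mu f (⋁ S) = ⋁ (image (convolution mu f) S).
Proof.
apply: sup_hom_eq => a; rewrite /convolution hom_supE !sh_compE tmap_homr hom_supE.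
by rewrite !(sh_sup Delta) !sup_image_comp.
Qed.

End ConvolutionTheory.

(* The elements of [hom R Omega] correspond to the overt weakly closed sublocales
   of R. *)
Definition mult_quantale : quantale :=
  Quantale (convolutionA (@ls_mulA R)) (convolutionC (@ls_mulC R))
    (convolution1 (@ls_mul1 R)) (convolution_sup (ls_mul R)).

Definition closed_add (f g : mult_quantale) : mult_quantale :=
  convolution (ls_add R) f g.

Definition closed_zero : mult_quantale := qh_sup_hom (ls_zero R).

Definition mtop (W : mult_quantale) : mult_quantale := W · top mult_quantale.

Lemma mtop_mono W V : W ⊑ V -> mtop W ⊑ mtop V.
Proof. by move=> h; apply: qmul_mono => //; apply: le_refl. Qed.

Lemma mtop_infl W : W ⊑ mtop W.
Proof.
rewrite -{1}(qmulr1 W); apply: qmul_mono; [exact: le_refl|exact: le_top].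
Qed.

Lemma mtop_idem W : mtop (mtop W) ⊑ mtop W.
Proof. rewrite /mtop qmul_topA; exact: le_refl. Qed.

Lemma mtop_mul W V : mtop W · mtop V ⊑ mtop (W · V).
Proof.
rewrite /mtop qmulACA qmulA; exact: mtop_idem.
Qed.

Definition mtop_nucleus : nucleus mult_quantale :=
  Nucleus mtop_mono mtop_infl mtop_idem mtop_mul.

Definition monoid_ideals : quantale := quot mtop_nucleus.

(* A generating inequality a + b ≤ a ∨ b is imposed as the equation
   (a + b) ∨ (a ∨ b) = a ∨ b. *)
Inductive ideal_rel : relation mult_quantale :=
| IdealRel_top : ideal_rel qone (top mult_quantale)
| IdealRel_zero : ideal_rel closed_zero (bot mult_quantale)
| IdealRel_add a b : ideal_rel (join (closed_add a b) (join a b)) (join a b).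

Definition Idl_quantale : quantale := quot (cong_nucleus ideal_rel).

Lemma Idl_top : qone = top Idl_quantale.
Proof.
apply: le_anti; first exact: le_top.
have h : le (s := mult_quantale) (sval (top Idl_quantale)) (class_top ideal_rel qone).
  rewrite (class_top_gen IdealRel_top).
  exact: le_trans (le_top _) (class_top_infl _ _).
exact: h.
Qed.

Definition Idl : two_sided := TwoSided Idl_top.

Definition Idl_map : quantale_hom mult_quantale Idl := quot_map (cong_nucleus ideal_rel).

Lemma Idl_map_mtop W : Idl_map (mtop_nucleus W) = Idl_map W.
Proof.
rewrite [mtop_nucleus W]/(W · top mult_quantale) qh_mul.
have -> : Idl_map (top mult_quantale) = qone.
  by apply: quot_eq; rewrite /= -(class_top_gen IdealRel_top).
exact: qmulr1.
Qed.

Definition frak_s : quantale_hom monoid_ideals Idl := quot_factor Idl_map_mtop.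

Lemma monoid_ideals_sup (S : monoid_ideals -> Prop) :
  sval (⋁ S) = ⋁ (image sval S).
Proof.
transitivity (mtop (⋁ (image sval S))); first by [].
rewrite /mtop qmul_supl sup_image_comp.
by apply: eq_sup_image => I _; apply: (svalP I).
Qed.

Lemma eval_supl S (I : monoid_ideals) :
  (sval I : sup_hom _ _) (kappa R (⋁ S)) =
  ⋁ (image (fun s => (sval I : sup_hom _ _) (kappa R s)) S).
Proof. by rewrite !sh_sup sup_image_comp. Qed.

Lemma eval_supr (s : saturated_opens R) (S : monoid_ideals -> Prop) :
  (sval (⋁ S) : sup_hom _ _) (kappa R s) =
  ⋁ (image (fun I : monoid_ideals => (sval I : sup_hom _ _) (kappa R s)) S).
Proof. by rewrite monoid_ideals_sup hom_supE sup_image_comp. Qed.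

Definition evaluation : sup_hom (saturated_opens R ⊗ monoid_ideals) Omega :=
  lift (Bihom eval_supl eval_supr).

End Ideals.

(* Main.v *)
(* Overtness makes the injection s ↦ s ⊗ 1 of OR into OR ⊗ OR right adjoint to
   slicing at the positivity predicate, so the saturated opens are reflective in
   the opens, with a reflector sigma such that I · ⊤ = I sigma. Hence the saturated
   opens are a retract of the opens, the monoid ideals are their dual, and an
   element w of Q ⊗ R invariant under Q ⊗ sigma is the same as a join-preserving
   map f ↦ (Q ⊗ f)(w) from the monoid ideals to Q. Every OPAI w is invariant, and
   its equations say that f ↦ (Q ⊗ f)(w) is a quantale homomorphism on hom(R, Ω)
   which identifies the relations defining Idl(R). For the universal element this
   map is the quotient map to Idl(R); since it satisfies the ideal relations, and
   elements of Q ⊗ R ⊗ R can be tested on pairs of monoid ideals up to saturation,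
   the universal element is an OPAI. *)

Require Import Defs.
From Corelib Require Import ssreflect ssrfun.
From Stdlib Require Import PropExtensionality.

Set Implicit Arguments.
Unset Strict Implicit.
Unset Printing Implicit Defensive.

#[local] Opaque pure tmap lift lunit runit swap assoc assocV.

(** * Scaling by truth values, and maps on pure tensors *)

Lemma top_Omega : top Omega = True.
Proof. by apply: propositional_extensionality; split=> // _; exists True. Qed.

Lemma sh_scale (A B : suplattice) (f : sup_hom A B) (p : Omega) (a : A) :
  f (scale p a) = scale p (f a).
Proof.
apply: eq_ub => z; rewrite scaleP sh_sup sup_imageP.
by split=> [h Pp|h _ [Pp ->]]; apply: h.
Qed.

Lemma scale_scale (A : suplattice) (p q : Omega) (a : A) :
  scale p (scale q a) = scale (p /\ q) a.
Proof.
apply: eq_ub => z; split=> /scaleP h; apply/scaleP.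
  by move=> [/h /scaleP k Pq]; apply: k.
by move=> Pp; apply/scaleP => Pq; apply: h; split.
Qed.

Lemma scale_mul (Q : quantale) (p q : Omega) (a b : Q) :
  scale p a · scale q b = scale (p /\ q) (a · b).
Proof.
rewrite -[_ · _]/(qmulh (scale p a) _) sh_scale /= qmulC.
by rewrite -[_ · _]/(qmulh b _) sh_scale /= scale_scale Omega_mulC qmulC.
Qed.

Definition pure_hl (A B : suplattice) (b : B) : sup_hom A (A ⊗ B) :=
  @SupHom A (A ⊗ B) (fun a => a ⊠ b) (fun S => pure_supl S b).

Definition pure_hr (A B : suplattice) (a : A) : sup_hom B (A ⊗ B) :=
  @SupHom B (A ⊗ B) (fun b => a ⊠ b) (pure_supr a).

Lemma pure_mono (A B : suplattice) (a a' : A) (b b' : B) :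
  a ⊑ a' -> b ⊑ b' -> a ⊠ b ⊑ a' ⊠ b'.
Proof.
move=> ha hb; apply: (@le_trans _ (a' ⊠ b)).
  exact: (sh_mono (pure_hl _ b) ha).
exact: (sh_mono (pure_hr _ a') hb).
Qed.

Lemma pure_scalel (A B : suplattice) (p : Omega) (a : A) (b : B) :
  scale p a ⊠ b = scale p (a ⊠ b).
Proof. exact: (sh_scale (pure_hl _ b)). Qed.

Lemma pure_scaler (A B : suplattice) (p : Omega) (a : A) (b : B) :
  a ⊠ scale p b = scale p (a ⊠ b).
Proof. exact: (sh_scale (pure_hr _ a)). Qed.

Lemma tensor_ext3r (A B C D : suplattice) (f g : sup_hom (A ⊗ (B ⊗ C)) D) :
  (forall a b c, f (a ⊠ (b ⊠ c)) = g (a ⊠ (b ⊠ c))) -> forall t, f t = g t.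
Proof.
move=> e; apply: tensor_ext => a.
by apply: (tensor_ext (f := f ∘ pure_hr _ a) (g := g ∘ pure_hr _ a)); apply: e.
Qed.

Lemma tensor_le_ext (A B C : suplattice) (f g : sup_hom (A ⊗ B) C) :
  (forall a b, f (a ⊠ b) ⊑ g (a ⊠ b)) -> forall t, f t ⊑ g t.
Proof.
move=> e; apply: tensor_ind => // F h.
rewrite !sh_sup; apply/sup_imageP => U FU.
by apply: le_trans (h U FU) _; apply: sup_ub; exists U.
Qed.

Lemma tmap_mono (A A' B B' : suplattice) (f f' : sup_hom A A')
    (g g' : sup_hom B B') t :
  (forall a, f a ⊑ f' a) -> (forall b, g b ⊑ g' b) -> tmap f g t ⊑ tmap f' g' t.
Proof.
move=> hf hg; move: t; apply: tensor_le_ext => a b.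
by rewrite !tmapE; apply: pure_mono.
Qed.

Lemma eq_tmap (A A' B B' : suplattice) (f f' : sup_hom A A')
    (g g' : sup_hom B B') t :
  f =1 f' -> g =1 g' -> tmap f g t = tmap f' g' t.
Proof.
move=> hf hg; congr (sh_fun (tmap _ _) _); exact: sup_hom_eq.
Qed.

Lemma scale_OmegaE (p q : Omega) : scale p q = (p /\ q).
Proof. rewrite -lunitE; exact: DeltaE. Qed.

Lemma scale_Omega (p : Omega) : scale p (True : Omega) = p.
Proof. by rewrite scale_OmegaE Omega_mulC Omega_mul1. Qed.

(** * Slices of tensors at join-preserving maps to [Omega] *)

Lemma runit_inj (A : suplattice) (t t' : A ⊗ Omega) :
  runit A t = runit A t' -> t = t'.
Proof.
have K (x : A ⊗ Omega) : runitV A (runit A x) = x.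
  move: x; apply: (tensor_ext (f := runitV A ∘ runit A) (g := sh_id _)) => a p.
  rewrite sh_compE runitE /= pure_scalel -pure_scaler; congr (_ ⊠ _).
  exact: scale_Omega.
by move=> e; rewrite -(K t) e K.
Qed.

(* The map f ↦ (A ⊗ f)(t) from hom(B, Ω) to A. *)
Definition slice (A B : suplattice) (t : A ⊗ B) (f : hom B Omega) : A :=
  runit A (tmap (sh_id A) f t).

Lemma slice_supr (A B : suplattice) (t : A ⊗ B) (F : hom B Omega -> Prop) :
  slice t (⋁ F) = ⋁ (image (slice t) F).
Proof. by rewrite /slice tmap_homr hom_supE sh_sup !sup_image_comp. Qed.

Definition slice_hom (A B : suplattice) (t : A ⊗ B) : sup_hom (hom B Omega) A :=
  SupHom (slice_supr t).

Lemma slice_supl (A B : suplattice) (F : A ⊗ B -> Prop) (f : hom B Omega) :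
  slice (⋁ F) f = ⋁ (image (fun t => slice t f) F).
Proof. by rewrite /slice !sh_sup !sup_image_comp. Qed.

Definition slice_at (A B : suplattice) (f : hom B Omega) : sup_hom (A ⊗ B) A :=
  SupHom (fun F => slice_supl F f).

Lemma slice_pure (A B : suplattice) (a : A) (b : B) (f : hom B Omega) :
  slice (a ⊠ b) f = scale (f b) a.
Proof. by rewrite /slice tmapE runitE. Qed.

#[local] Opaque slice.

Lemma slice_tmap (A A' B B' : suplattice) (g : sup_hom A A') (h : sup_hom B B')
    (t : A ⊗ B) (f : hom B' Omega) :
  slice (tmap g h t) f = g (slice t (f ∘ h)).
Proof.
move: t; apply: (tensor_ext (f := slice_at A' f ∘ tmap g h)
  (g := g ∘ slice_at A (f ∘ h : hom _ _))) => a b.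
by rewrite /= tmapE !slice_pure sh_scale.
Qed.

Lemma slice_mono (A B : suplattice) (t : A ⊗ B) (f g : hom B Omega) :
  f ⊑ g -> slice t f ⊑ slice t g.
Proof. exact: (sh_mono (slice_hom t)). Qed.

(** Slicing in either order computes the value of [f ⊗ g] at [t]. *)
Lemma slice_swap (A B : suplattice) (t : A ⊗ B) (f : hom A Omega) (g : hom B Omega) :
  g (slice (swap A B t) f) = f (slice t g).
Proof.
move: t; apply: (tensor_ext (f := (g : sup_hom _ _) ∘ slice_at B f ∘ swap A B)
  (g := (f : sup_hom _ _) ∘ slice_at A g)) => a b.
by rewrite /= swapE !slice_pure !sh_scale !scale_OmegaE Omega_mulC.
Qed.

Lemma swap_tmap (A A' B B' : suplattice) (f : sup_hom A A') (g : sup_hom B B') t :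
  swap A' B' (tmap f g t) = tmap g f (swap A B t).
Proof.
move: t; apply: (tensor_ext (f := swap A' B' ∘ tmap f g) (g := tmap g f ∘ swap A B)).
by move=> a b; rewrite /= !(tmapE, swapE).
Qed.

Lemma slice_swapE (A B : suplattice) (t : A ⊗ B) (f : hom A Omega) :
  slice (swap A B t) f = lunit B (tmap f (sh_id B) t).
Proof.
move: t; apply: (tensor_ext (f := slice_at B f ∘ swap A B)
  (g := lunit B ∘ tmap f (sh_id B))) => a b.
by rewrite /= swapE slice_pure tmapE lunitE.
Qed.

Lemma Delta_tmap (A B : suplattice) (t : A ⊗ B) (f : hom A Omega) (g : hom B Omega) :
  Delta (tmap f g t) = f (slice t g).
Proof.
move: t; apply: (tensor_ext (f := Delta ∘ tmap f g)
  (g := (f : sup_hom _ _) ∘ slice_at A g)) => a b.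
by rewrite /= tmapE slice_pure sh_scale DeltaE scale_OmegaE Omega_mulC.
Qed.

Lemma slice_assoc (A B C : suplattice) (t : A ⊗ B ⊗ C) (f : hom C Omega) :
  slice t f = tmap (sh_id A) (slice_at B f) (assoc A B C t).
Proof.
move: t; apply: (tensor_ext3 (f := slice_at (A ⊗ B) f)
  (g := tmap (sh_id A) (slice_at B f) ∘ assoc A B C)) => a b c.
by rewrite /= assocE tmapE /= !slice_pure pure_scaler.
Qed.

Lemma slice_assocV (P A B : suplattice) (x : P ⊗ (A ⊗ B)) (f : hom A Omega)
    (g : hom B Omega) :
  slice (slice (assocV P A B x) g) f = slice x (Delta ∘ tmap f g).
Proof.
move: x; apply: (tensor_ext3r (f := slice_at P f ∘ slice_at (P ⊗ A) g ∘ assocV P A B)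
  (g := slice_at P (Delta ∘ tmap f g : hom _ _))) => p a b.
rewrite /= assocVE !slice_pure sh_compE tmapE DeltaE -[LHS]/(slice_at P f _).
by rewrite sh_scale /= slice_pure scale_scale Omega_mulC.
Qed.

(** * Duality in terms of slices *)

Section Duality.
Variables (A B : suplattice) (eps : sup_hom (A ⊗ B) Omega).

Definition pair_l (a : A) : hom B Omega := eps ∘ pure_hr _ a.

Definition pair_r (b : B) : hom A Omega := eps ∘ pure_hl _ b.

Lemma pair_r_sup S : pair_r (⋁ S) = ⋁ (image pair_r S).
Proof.
apply: sup_hom_eq => a.
by rewrite -[LHS]/(eps (a ⊠ ⋁ S)) pure_supr sh_sup hom_supE !sup_image_comp.
Qed.

Definition pair_rh : sup_hom B (hom A Omega) := SupHom pair_r_sup.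

(** The triangle composites only involve [eta True], and on a pure tensor each of them reduces to a
    slice at the functional that an element defines. *)
Lemma dualityP (eta : sup_hom Omega (B ⊗ A)) :
  duality eta eps <->
    (forall a, slice (swap B A (eta True)) (pair_l a) = a) /\
    (forall b, slice (eta True) (pair_r b) = b).
Proof.
have hl a t : slice (swap B A t) (pair_l a)
    = lunit A (tmap eps (sh_id A) (assocV A B A (a ⊠ t))).
  move: t; apply: (tensor_ext (f := slice_at A (pair_l a) ∘ swap B A)
    (g := lunit A ∘ tmap eps (sh_id A) ∘ assocV A B A ∘ pure_hr _ a)).
  move=> b a'; rewrite /= swapE slice_pure /=.
  by rewrite assocVE tmapE lunitE.
have hr b t : slice t (pair_r b)
    = runit B (tmap (sh_id B) eps (assoc B A B (t ⊠ b))).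
  move: t; apply: (tensor_ext (f := slice_at B (pair_r b))
    (g := runit B ∘ tmap (sh_id B) eps ∘ assoc B A B
          ∘ pure_hl _ b)).
  move=> b' a; rewrite /= slice_pure /=.
  by rewrite assocE tmapE runitE.
split=> [[dl dr]|[dl dr]]; split=> x.
- by rewrite hl -{2}(dl x) !sh_compE /= tmapE.
- by rewrite hr -{2}(dr x) !sh_compE /= tmapE.
- by rewrite !sh_compE /= tmapE -hl dl.
- by rewrite !sh_compE /= tmapE -hr dr.
Qed.

(** Dual-basis expansion: when [eta True] is a join of tensors [b ⊠ a], the element [v] is the join
    of its slices at [pair_r b] tensored with [a]. Thus [v] is determined by its slices at
    functionals coming from [B]. *)
Lemma duality_expand (Q : suplattice) (eta : sup_hom Omega (B ⊗ A)) (v : Q ⊗ A) :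
  duality eta eps ->
  tmap (slice_hom v ∘ pair_rh) (sh_id A) (eta True) = v.
Proof.
move=> /dualityP [dl _]; move: v; apply: tensor_ind => [q a|F h].
  rewrite -{2}(dl a); move: (eta True).
  apply: (tensor_ext (g := pure_hr _ q ∘ slice_at A (pair_l a) ∘ swap B A)).
  move=> b a'; rewrite /= swapE tmapE /= !slice_pure /=.
  by rewrite pure_scaler pure_scalel.
pose S : hom B Q -> Prop := image (fun v => slice_hom v ∘ pair_rh : hom B Q) F.
transitivity (tmap (⋁ S : hom B Q) (sh_id A) (eta True)).
  by apply: eq_tmap => // b; rewrite hom_supE /= slice_supl !sup_image_comp.
rewrite tmap_homl hom_supE !sup_image_comp.
rewrite (eq_sup_image (g := sh_id _) h); exact: esym (sh_sup (sh_id _) F).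
Qed.

(** Expanding [eta True] by means of [eta'] produces slices of [eta True], which the triangle
    identity for [eta] computes. *)
Lemma duality_unit_unique (eta eta' : sup_hom Omega (B ⊗ A)) :
  duality eta eps -> duality eta' eps -> eta = eta'.
Proof.
move=> d d'; have e : eta True = eta' True.
  rewrite -(duality_expand (eta True) d') -[RHS]tmap_id.
  by apply: eq_tmap => // b; case/dualityP: d => _; apply.
by apply: sup_hom_eq => p; rewrite -(scale_Omega p) !sh_scale e.
Qed.

End Duality.

(** * Two-sided tensor products and slices of products *)

Lemma tensor_le_one (Q Q' : two_sided) (t : Q ⊕ Q') : t ⊑ (qone : Q ⊕ Q').
Proof.
move: t; apply: tensor_ind => [a b|F h]; last exact: sup_lub.
by apply: pure_mono; rewrite ts_top; apply: le_top.
Qed.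

Lemma tensor_top (Q Q' : two_sided) : (qone : Q ⊕ Q') = top (Q ⊕ Q').
Proof. by apply: (@le_anti (Q ⊗ Q')); [apply: le_top|apply: tensor_le_one]. Qed.

Definition tensor_two_sided (Q Q' : two_sided) : two_sided := TwoSided (tensor_top Q Q').

Lemma mul_le_l (Q : two_sided) (a b : Q) : a · b ⊑ a.
Proof.
rewrite -{2}(qmulr1 a) ts_top; apply: qmul_mono; [exact: le_refl|exact: le_top].
Qed.

Lemma hom_kernel_congruence (P Q : quantale) (h : quantale_hom P Q) :
  congruence (fun x y => h x = h y).
Proof.
split; first split.
- by [].
- by move=> x y z -> ->.
- by move=> x y ->.
- by move=> a a' b b' ea eb; rewrite !qh_mul ea eb.
- move=> S e; rewrite !sh_sup; apply: eq_sup => z; split.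
    by move=> [x [y Sxy] <-]; exists y; [exists x|rewrite (e _ _ Sxy)].
  by move=> [y [x Sxy] <-]; exists x; [exists y|rewrite (e _ _ Sxy)].
Qed.

(** For [w = w'] this is the right-hand side of the multiplicative condition on an OPAI. Separate
    arguments make it join-preserving in each, so that it can be computed on pure tensors. *)
Definition inl_inr (Q B C : quantale) (w : Q ⊕ B) (w' : Q ⊕ C) : Q ⊕ (B ⊕ C) :=
  (tmap (qh_id Q) (tinl B C) w : Q ⊕ (B ⊕ C)) · tmap (qh_id Q) (tinr B C) w'.

Section InlMulInr.
Variables (Q B C : quantale) (w : Q ⊕ B) (w' : Q ⊕ C).

Lemma inl_inr_pure (a c : Q) (b : B) (d : C) :
  inl_inr (a ⊠ b) (c ⊠ d) = (a · c) ⊠ (b ⊠ d).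
Proof.
rewrite /inl_inr !tmapE pure_mul; congr (_ ⊠ _).
by rewrite [LHS](pure_mul b qone qone d) qmul1 qmulr1.
Qed.

Lemma inl_inr_supl (F : Q ⊗ B -> Prop) (v : Q ⊕ C) :
  inl_inr (⋁ F) v = ⋁ (image (fun t => inl_inr t v) F).
Proof. by rewrite /inl_inr sh_sup (@qmul_supl (Q ⊕ (B ⊕ C))) sup_image_comp. Qed.

Lemma inl_inr_supr (F : Q ⊗ C -> Prop) (v : Q ⊕ B) :
  inl_inr v (⋁ F) = ⋁ (image (fun t => inl_inr v t) F).
Proof. by rewrite /inl_inr sh_sup (@qmul_sup (Q ⊕ (B ⊕ C))) sup_image_comp. Qed.

Lemma slice_inl_inr (f : hom B Omega) (g : hom C Omega) :
  slice (inl_inr w w') (Delta ∘ tmap f g) = slice w f · slice w' g.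
Proof.
move: w; apply: tensor_ind => [a b|F h]; last first.
  rewrite inl_inr_supl !slice_supl qmul_supl !sup_image_comp.
  exact: eq_sup_image.
move: w'; apply: tensor_ind => [c d|F h]; last first.
  rewrite inl_inr_supr !slice_supl qmul_sup !sup_image_comp.
  exact: eq_sup_image.
by rewrite inl_inr_pure !slice_pure sh_compE tmapE DeltaE scale_mul.
Qed.

Lemma tmap_inl_inr (f : sup_hom B B) (g : sup_hom C C) :
  tmap (sh_id Q) (tmap f g) (inl_inr w w') =
  inl_inr (tmap (sh_id Q) f w) (tmap (sh_id Q) g w').
Proof.
move: w; apply: tensor_ind => [a b|F h]; last first.
  rewrite inl_inr_supl (sh_sup (tmap _ (tmap f g))) (sh_sup (tmap _ f)) inl_inr_supl !sup_image_comp.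
  exact: eq_sup_image.
move: w'; apply: tensor_ind => [c d|F h]; last first.
  rewrite inl_inr_supr (sh_sup (tmap _ (tmap f g))) (sh_sup (tmap _ g)) inl_inr_supr !sup_image_comp.
  exact: eq_sup_image.
by rewrite inl_inr_pure (tmapE (sh_id Q) f) (tmapE _ g) inl_inr_pure !tmapE.
Qed.

End InlMulInr.

Lemma slice_qtmap (Q : quantale) (B C : suplattice) (h : sup_hom B C) (t : Q ⊗ B)
    (f : hom C Omega) :
  slice (tmap (qh_id Q) h t) f = slice t (f ∘ h).
Proof. exact: slice_tmap. Qed.
Lemma slice_tinl (A B : quantale) (a : A) (f : hom B Omega) :
  slice (tinl A B a) f ⊑ a.
Proof. by rewrite slice_pure; apply/scaleP => _; apply: le_refl. Qed.

(** Only an inequality: the slice on the left carries the additional factor [g qone]. *)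
Lemma slice_inl_le (Q B C : quantale) (w : Q ⊗ B) (f : hom B Omega)
    (g : hom C Omega) :
  slice (tmap (qh_id Q) (tinl B C) w) (Delta ∘ tmap f g) ⊑ slice w f.
Proof.
rewrite slice_qtmap; apply: slice_mono => a.
by rewrite !sh_compE tmapE DeltaE => -[].
Qed.

Lemma slice_inr_le (Q B C : quantale) (w : Q ⊗ C) (f : hom B Omega)
    (g : hom C Omega) :
  slice (tmap (qh_id Q) (tinr B C) w) (Delta ∘ tmap f g) ⊑ slice w g.
Proof.
rewrite slice_qtmap; apply: slice_mono => a.
by rewrite !sh_compE tmapE DeltaE => -[].
Qed.

Lemma precomp_sup (A B C : suplattice) (f : sup_hom A B) (S : hom B C -> Prop) :
  ((⋁ S : hom B C) ∘ f : hom A C) = ⋁ (image (fun g : hom B C => g ∘ f : hom A C) S).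
Proof.
by apply: sup_hom_eq => a; rewrite sh_compE !hom_supE sup_image_comp.
Qed.

Definition precomp (A B C : suplattice) (f : sup_hom A B) :
  sup_hom (hom B C) (hom A C) := SupHom (@precomp_sup A B C f).

Lemma positive_mono (A : suplattice) (a b : A) : a ⊑ b -> positive a -> positive b.
Proof. by move=> ab pa I bI; apply: pa; apply: le_trans bI. Qed.

Lemma saturated_eq (R : localic_semiring) (s t : saturated_opens R) : kappa R s = kappa R t -> s = t.
Proof.
move=> e; apply: (@le_anti (saturated_opens R)); rewrite /= /sat_le.
  by rewrite -[sval s]/(kappa R s) e; apply: le_refl.
by rewrite -[sval s]/(kappa R s) e; apply: le_refl.
Qed.

Lemma Idl_map_add (R : localic_semiring) (f g : mult_quantale R) :
  Idl_map R (closed_add f g) ⊑ join (Idl_map R f) (Idl_map R g).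
Proof.
rewrite -sh_join.
have <- : Idl_map R (join (closed_add f g) (join f g)) = Idl_map R (join f g).
  by apply: quot_eq; apply: class_top_gen; apply: IdealRel_add.
by apply: sh_mono; apply: sup_ub; left.
Qed.

(* f + g is supported where both f and g are nonempty; this accounts for the
   factors f(1) and g(1) that appear in slices of the coproduct injections. *)
Lemma closed_add_scale (R : localic_semiring) (f g : mult_quantale R) :
  closed_add f g ⊑
    scale ((f : hom R Omega) qone /\ (g : hom R Omega) qone) (closed_add f g).
Proof.
move=> a fga; have k : (f : hom R Omega) qone /\ (g : hom R Omega) qone.
  rewrite -DeltaE -tmapE.
  exact: (sh_mono (Delta ∘ tmap f g) (@tensor_le_one R R (ls_add R a)) fga).
have h : closed_add f g ⊑
    scale ((f : hom R Omega) qone /\ (g : hom R Omega) qone) (closed_add f g).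
  exact: sup_ub (conj k erefl).
exact: h.
Qed.

(** * Positivity and saturation in an overt semiring *)

Section Overt.
Variable R : localic_semiring.
Hypothesis R_overt : overt R.

Lemma positive_sup (S : R -> Prop) :
  (positive (⋁ S) : Omega) = ⋁ (image (fun a : R => positive a : Omega) S).
Proof.
apply: propositional_extensionality; split=> [|[_ [s Ss <-]]]; last first.
  by apply: positive_mono; apply: sup_ub.
case: R_overt => B Bpos Bbase pS.
(* The base elements below some member of [S] cover [⋁ S]; positivity provides one of them, and the
   member above it is then positive. *)
case: (pS (fun b => B b /\ exists2 s, S s & b ⊑ s)).
  apply: sup_lub => s Ss; rewrite (Bbase s); apply: sup_lub => b [Bb bs].
  by apply: sup_ub; split=> //; exists s.
move=> b [Bb [s Ss bs]]; exists (positive s); first by exists s.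
by apply: positive_mono bs _; apply: Bpos.
Qed.

Definition pos : hom R Omega := SupHom positive_sup.

(** A join-preserving map that is true at [a] is true at some member of any cover of [a], so every
    such cover is inhabited. *)
Lemma top_pos : top (hom R Omega) = pos.
Proof.
apply: le_anti; last exact: le_top.
move=> a fa I aI; have := sh_mono (top (hom R Omega)) aI fa.
by rewrite sh_sup => -[_ [i Ii _] _]; exists i.
Qed.

(** Unit of the adjunction between positivity and [p ↦ scale p (top R)]: each base element below [a]
    witnesses that [a] is positive. *)
Lemma le_scale_pos (a : R) : a ⊑ scale (pos a) (top R).
Proof.
case: R_overt => B Bpos Bbase; rewrite {1}(Bbase a).
apply: sup_lub => b [Bb ba]; apply: le_trans (le_top b) _.
by apply: sup_ub; split=> //; apply: positive_mono ba _; apply: Bpos.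
Qed.

(* In terms of points, [sigma a] consists of the x such that xr is in [a] for
   some r: it is the least saturated open above [a]. *)
Definition sigma : sup_hom R R := slice_at R pos ∘ ls_mul R.

(** Slicing the multiplication at the point one gives back [a], and [pos] dominates every
    functional. *)
Lemma le_sigma (a : R) : a ⊑ sigma a.
Proof.
rewrite -{1}(ls_mul1 a) -(slice_swapE (ls_mul R a) (qh_sup_hom (ls_one R))).
rewrite ls_mulC; apply: slice_mono; rewrite -top_pos; exact: le_top.
Qed.

Lemma sigma_le (s : R) : saturated s -> sigma s = s.
Proof.
move=> h; apply: le_anti; last exact: le_sigma.
apply: le_trans (slice_tinl (B := R) s pos).
exact: (sh_mono (slice_at R pos) h).
Qed.

(** In terms of points, [(xy)r = x(yr)]: the multiplier that saturates a product can be absorbed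
    into its second factor. *)
Lemma mul_sigma (a : R) : ls_mul R (sigma a) = tmap (sh_id R) sigma (ls_mul R a).
Proof.
have -> : ls_mul R (sigma a) = slice (tmap (ls_mul R) (qh_id R) (ls_mul R a)) pos.
  rewrite slice_tmap; congr (ls_mul R (slice _ _)); exact: sup_hom_eq.
rewrite slice_assoc ls_mulA tmap_comp; exact: eq_tmap.
Qed.

Lemma sigma_mul (a : R) : tmap sigma (sh_id R) (ls_mul R a) = ls_mul R (sigma a).
Proof. by rewrite -{1}(ls_mulC a) -swap_tmap -mul_sigma ls_mulC. Qed.

(** By the unit of the adjunction between slicing at [pos] and [b ↦ b ⊠ qone], [ls_mul R a] lies
    below [sigma a ⊠ qone]; applying [sigma] in the second variable turns the left side into
    [ls_mul R (sigma a)]. *)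
Lemma sigma_saturated (a : R) : saturated (sigma a).
Proof.
have h : ls_mul R a ⊑ tinl R R (slice (ls_mul R a) pos).
  move: (ls_mul R a).
  apply: (tensor_le_ext (f := sh_id _) (g := tinl R R ∘ slice_at R pos)).
  move=> b c; rewrite /= slice_pure pure_scalel -pure_scaler ts_top.
  exact: pure_mono (le_refl _) (le_scale_pos _).
rewrite /saturated mul_sigma.
apply: le_trans (sh_mono (tmap (sh_id R) sigma) h) _.
rewrite /= tmapE; apply: pure_mono; first exact: le_refl.
rewrite ts_top; exact: le_top.
Qed.

Lemma sigma_one : sigma qone = qone.
Proof.
apply: le_anti (le_sigma _); rewrite {2}ts_top; exact: le_top.
Qed.

Lemma sigma2_mul (a : R) :
  tmap sigma sigma (ls_mul R (sigma a)) = ls_mul R (sigma a).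
Proof.
have i (b : R) : sigma (sigma b) = sigma b := sigma_le (@sigma_saturated b).
transitivity (tmap (sh_id R) sigma (tmap sigma (sh_id R) (ls_mul R (sigma a)))).
  by rewrite tmap_comp; apply: eq_tmap.
by rewrite sigma_mul -mul_sigma !i.
Qed.

(** * The retraction onto saturated opens and their duality with monoid ideals *)

Definition sat_fun (a : R) : saturated_opens R := exist _ (sigma a) (@sigma_saturated a).

Lemma sat_sup_subproof (S : R -> Prop) : sat_fun (⋁ S) = ⋁ (image sat_fun S).
Proof.
apply: saturated_eq; rewrite -[LHS]/(sigma (⋁ S)) sh_sup.
by rewrite [RHS](sh_sup (kappa R)) sup_image_comp.
Qed.

Definition sat : sup_hom R (saturated_opens R) := SupHom sat_sup_subproof.

Lemma sigma_kappa (s : saturated_opens R) : sigma (kappa R s) = kappa R s.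
Proof. exact: sigma_le (svalP s). Qed.

Lemma sat_kappa (s : saturated_opens R) : sat (kappa R s) = s.
Proof. by apply: saturated_eq; apply: sigma_kappa. Qed.

Lemma mtopE (W : mult_quantale R) (a : R) :
  (mtop W : hom R Omega) a = (W : hom R Omega) (sigma a).
Proof. by rewrite /mtop top_pos; apply: Delta_tmap. Qed.

Lemma pair_r_evaluation (I : monoid_ideals R) :
  pair_r (evaluation R) I = (sval I : hom R Omega) ∘ kappa R.
Proof. by apply: sup_hom_eq => s; apply: liftE. Qed.

Definition mono_ideal : quantale_hom (mult_quantale R) (monoid_ideals R) :=
  quot_map (mtop_nucleus R).

Lemma mono_ideal_sval (I : monoid_ideals R) : mono_ideal (sval I) = I.
Proof. by apply: quot_eq; apply: (svalP I). Qed.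

(** Passing to the generated monoid ideal is precomposition with [sigma], which fixes saturated
    opens. *)
Lemma mono_ideal_kappa (f : hom R Omega) :
  (sval (mono_ideal f) : hom R Omega) ∘ kappa R = f ∘ kappa R.
Proof.
apply: sup_hom_eq => s; rewrite !sh_compE.
by rewrite -[LHS]/((mtop (f : mult_quantale R) : hom R Omega) (kappa R s)) mtopE sigma_kappa.
Qed.

Lemma evaluation_duality : dualisable (saturated_opens R) ->
  exists eta, duality eta (evaluation R).
Proof.
move=> [B [eta [eps /dualityP [dl _]]]].
(* An element of the given dual [B] acts as a functional on saturated opens; composing with [sat]
   extends it to all opens, and [mono_ideal] makes it a monoid ideal. *)
pose phi : sup_hom B (monoid_ideals R) :=
  mono_ideal ∘ (precomp _ sat : sup_hom _ (mult_quantale R)) ∘ pair_rh eps.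
exists (tmap phi (sh_id _) ∘ eta); apply/dualityP; split=> [s|I]; rewrite sh_compE.
  have e : (pair_l (evaluation R) s ∘ phi : hom B Omega) = pair_l eps s.
    apply: sup_hom_eq => b.
    rewrite -[LHS]/(pair_r (evaluation R) (phi b) s) pair_r_evaluation.
    rewrite mono_ideal_kappa.
    exact: (congr1 (fun s' => eps (s' ⊠ b)) (sat_kappa s)).
  by rewrite swap_tmap slice_tmap e dl.
rewrite slice_tmap pair_r_evaluation.
set h : hom _ _ := _ ∘ sh_id _.
(* Here [h] is the restriction of [I] to saturated opens; like every functional there, it is the
   pairing with an element of [B], namely the slice of [eta True] at it. *)
have e : pair_r eps (slice (eta True) h) = h.
  apply: sup_hom_eq => s.
  by rewrite -[LHS]/(pair_l eps s (slice (eta True) h)) -slice_swap dl.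
rewrite !sh_compE -[pair_rh _ _]/(pair_r eps (slice (eta True) h)) e.
rewrite -[RHS]mono_ideal_sval; congr (mono_ideal _).
(* A monoid ideal is unchanged by precomposition with [sigma], hence determined by its restriction
   to saturated opens. *)
rewrite -[RHS](svalP I); apply: sup_hom_eq => a.
exact: esym (mtopE _ _).
Qed.

(** * The universal element *)

Section Universal.
Variable eta : sup_hom Omega (monoid_ideals R ⊗ saturated_opens R).
Hypothesis eta_dual : duality eta (evaluation R).

(* By duality, the slices at monoid ideals determine the saturation of [x]. *)
Lemma le_tmap_sigma (P : suplattice) (x y : P ⊗ R) :
  (forall f, slice x f ⊑ slice y f) ->
  tmap (sh_id P) sigma x ⊑ tmap (sh_id P) sigma y.
Proof.
move=> xy; have h z : tmap (sh_id P) sigma z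
    = tmap (sh_id P) (kappa R) (tmap (sh_id P) sat z).
  by rewrite tmap_comp; apply: eq_tmap.
rewrite !h; apply: sh_mono.
rewrite -(duality_expand (tmap (sh_id P) sat x) eta_dual).
rewrite -[Y in _ ⊑ Y](duality_expand _ eta_dual).
apply: tmap_mono => I; last exact: le_refl.
by rewrite /= !slice_tmap; apply: xy.
Qed.

(** After reassociation, [le_tmap_sigma] applies to each copy of [R] in turn, so testing on product
    functionals suffices. *)
Lemma le_tmap_sigma2 (P : suplattice) (x y : P ⊗ (R ⊗ R)) :
  (forall f g : hom R Omega,
     slice x (Delta ∘ tmap f g) ⊑ slice y (Delta ∘ tmap f g)) ->
  tmap (sh_id P) (tmap sigma sigma) x ⊑ tmap (sh_id P) (tmap sigma sigma) y.
Proof.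
move=> xy; have h z : tmap (sh_id P) (tmap sigma sigma) z
    = assoc P R R (tmap (sh_id (P ⊗ R)) sigma
        (tmap (tmap (sh_id P) sigma) (sh_id R) (assocV P R R z))).
  move: z; apply: (tensor_ext3r (g := assoc P R R ∘ tmap (sh_id (P ⊗ R)) sigma
    ∘ tmap (tmap (sh_id P) sigma) (sh_id R) ∘ assocV P R R)) => p a b.
  by rewrite /= assocVE !(tmapE, assocE).
rewrite !h; apply: sh_mono; apply: le_tmap_sigma => g.
rewrite !slice_tmap; apply: le_tmap_sigma => f.
by rewrite !slice_assocV; apply: xy.
Qed.

Definition universal_elt : Idl R ⊕ R := tmap (frak_s R) (kappa R) (eta True).
Local Notation u := universal_elt.

(** By a triangle identity, slicing the unit of the duality at the restriction of [f] returns the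
    monoid ideal generated by [f]. *)
Lemma slice_universal (f : mult_quantale R) : slice u f = Idl_map R f.
Proof.
rewrite slice_tmap -(quot_factorE (@Idl_map_mtop R) f); congr (frak_s R _).
rewrite -[RHS](proj2 (proj1 (dualityP _ _) eta_dual)).
by rewrite pair_r_evaluation mono_ideal_kappa.
Qed.

Lemma universal_sigma : tmap (sh_id (Idl R)) sigma u = u.
Proof. by rewrite tmap_comp; apply: eq_tmap => // s; apply: sigma_kappa. Qed.

Lemma universal_is_OPAI : is_OPAI u.
Proof.
(* Since [u] comes from saturated opens, invariance of [m] on those passes to the image of [u]. *)
have inv2 (m : quantale_hom R (R ⊕ R)) :
    (forall s, tmap sigma sigma (m (kappa R s)) = m (kappa R s)) ->
    tmap (sh_id (Idl R)) (tmap sigma sigma) (tmap (qh_id (Idl R)) m u)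
      = tmap (qh_id (Idl R)) m u.
  by move=> h; rewrite !tmap_comp; apply: eq_tmap.
have il : tmap (sh_id (Idl R)) (tmap sigma sigma) (tmap (qh_id (Idl R)) (tinl R R) u)
    = tmap (qh_id (Idl R)) (tinl R R) u.
  by apply: inv2 => s; rewrite /= tmapE sigma_one; congr (_ ⊠ _); apply: sigma_kappa.
have ir : tmap (sh_id (Idl R)) (tmap sigma sigma) (tmap (qh_id (Idl R)) (tinr R R) u)
    = tmap (qh_id (Idl R)) (tinr R R) u.
  by apply: inv2 => s; rewrite /= tmapE sigma_one; congr (_ ⊠ _); apply: sigma_kappa.
have im : tmap (sh_id (Idl R)) (tmap sigma sigma) (tmap (qh_id (Idl R)) (ls_mul R) u)
    = tmap (qh_id (Idl R)) (ls_mul R) u.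
  by apply: inv2 => s; rewrite -{1}sigma_kappa sigma2_mul sigma_kappa.
split.
(* [runit] identifies [Idl R ⊗ Omega] with [Idl R], where the condition becomes an equation about a
   slice of [u]. *)
- apply: runit_inj; rewrite sh_bot -[LHS]/(slice u (qh_sup_hom (ls_zero R))).
  rewrite slice_universal -(sh_bot (Idl_map R)); apply: quot_eq.
  exact: class_top_gen (IdealRel_zero R).
- apply: runit_inj; rewrite -[LHS]/(slice u (qh_sup_hom (ls_one R))).
  by rewrite slice_universal (runitE (True : Omega)) scale_True -(qh_one (Idl_map R)).
(* The left side is first enlarged by saturating both variables; the right side is already
   invariant, by [il] and [ir]. *)
- have infl x : x ⊑ tmap (sh_id (Idl R)) (tmap sigma sigma) x.
    rewrite -{1}(tmap_id x); apply: tmap_mono => [a|t]; first exact: le_refl.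
    by rewrite -{1}(tmap_id t); apply: tmap_mono => a; apply: le_sigma.
  apply: le_trans (infl _) _.
  rewrite -[X in _ ⊑ join X _]il -[X in _ ⊑ join _ X]ir -sh_join.
  apply: le_tmap_sigma2 => f g.
  rewrite -[Y in _ ⊑ Y]/(slice_at _ (Delta ∘ tmap f g : hom _ _) _) sh_join.
  rewrite -![slice_at _ _ _]/(slice _ _) !slice_qtmap !slice_universal.
  (* Scaling makes [f qone] and [g qone] available as hypotheses; under these the slices on the
     right dominate the images of [f] and [g]. *)
  apply: (@le_trans _ _ _ _ (sh_mono (Idl_map R) (@closed_add_scale R f g))).
  rewrite sh_scale; apply/scaleP => -[f1 g1].
  apply: (@le_trans _ _ _ _ (@Idl_map_add R f g)); apply/joinP; split.
    apply: (@le_trans _ (Idl_map R (Delta ∘ tmap f g ∘ tinl R R))); last first.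
      by apply: sup_ub; left.
    by apply: (sh_mono (Idl_map R)) => a fa; rewrite !sh_compE tmapE DeltaE.
  apply: (@le_trans _ (Idl_map R (Delta ∘ tmap f g ∘ tinr R R))); last first.
    by apply: sup_ub; right.
  by apply: (sh_mono (Idl_map R)) => a fa; rewrite !sh_compE tmapE DeltaE.
- have ilr : tmap (sh_id (Idl R)) (tmap sigma sigma)
      ((qtmap (qh_id (Idl R)) (tinl R R) u : Idl R ⊕ (R ⊕ R))
         · qtmap (qh_id (Idl R)) (tinr R R) u)
      = qtmap (qh_id (Idl R)) (tinl R R) u · qtmap (qh_id (Idl R)) (tinr R R) u.
    transitivity (inl_inr (tmap (sh_id (Idl R)) sigma u) (tmap (sh_id (Idl R)) sigma u)).
      exact: tmap_inl_inr.
    by rewrite universal_sigma.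
  have e f g : slice (tmap (qh_id (Idl R)) (ls_mul R) u) (Delta ∘ tmap f g) =
      slice ((qtmap (qh_id (Idl R)) (tinl R R) u : Idl R ⊕ (R ⊕ R))
         · qtmap (qh_id (Idl R)) (tinr R R) u) (Delta ∘ tmap f g).
    by rewrite slice_inl_inr slice_qtmap !slice_universal -qh_mul.
  (* Both sides are invariant, so equal slices at product functionals force equality. *)
  rewrite -[LHS]im -[RHS]ilr; apply: le_anti; apply: le_tmap_sigma2 => f g;
    rewrite -?e; exact: le_refl.
Qed.

(** * The homomorphism that classifies an OPAI *)

Section Classify.
Variables (Q : two_sided) (w : Q ⊕ R).
Hypothesis w_opai : is_OPAI w.

(** A product in a two-sided quantale lies below its first factor, so the multiplicative condition
    gives [w] the inequality that defines saturated opens; slicing it at [pos] yields the nontrivial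
    half. *)
Lemma opai_sigma : tmap (sh_id Q) sigma w = w.
Proof.
apply: le_anti; last first.
  rewrite -{1}(tmap_id w); apply: tmap_mono => [a|a]; first exact: le_refl.
  exact: le_sigma.
have e : tmap (sh_id Q) (slice_at R pos) (tmap (sh_id Q) (ls_mul R) w)
    = tmap (sh_id Q) sigma w by rewrite tmap_comp; apply: eq_tmap.
rewrite -e; have h : tmap (sh_id Q) (ls_mul R) w ⊑ tmap (sh_id Q) (tinl R R) w.
  rewrite [X in X ⊑ _](opai_mul w_opai).
  exact: (@mul_le_l (tensor_two_sided Q (tensor_two_sided R R))).
apply: le_trans (sh_mono (tmap (sh_id Q) (slice_at R pos)) h) _.
rewrite tmap_comp -{2}(tmap_id w); apply: tmap_mono => [a|a]; first exact: le_refl.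
exact: slice_tinl.
Qed.

Definition classifier_sup : sup_hom (mult_quantale R) Q := slice_hom w.

Lemma classifier_mul f g : classifier_sup (f · g) = classifier_sup f · classifier_sup g.
Proof.
by rewrite /= -slice_inl_inr -[inl_inr w w](opai_mul w_opai) slice_qtmap.
Qed.

Lemma classifier_one : classifier_sup qone = qone.
Proof.
rewrite -[LHS]/(runit Q (qtmap (qh_id Q) (ls_one R) w)) (opai_one w_opai).
by rewrite (runitE (True : Omega)) scale_True.
Qed.

Definition classifier_hom : quantale_hom (mult_quantale R) Q :=
  QuantaleHom classifier_mul classifier_one.

Lemma classifier_add (f g : mult_quantale R) :
  classifier_hom (closed_add f g) ⊑ join (classifier_hom f) (classifier_hom g).
Proof.
have e : classifier_hom (closed_add f g)
    = slice (qtmap (qh_id Q) (ls_add R) w) (Delta ∘ tmap f g).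
  by rewrite slice_qtmap.
rewrite e; apply: (@le_trans _ _ _ _ (sh_mono (slice_at Q _) (opai_add w_opai))).
rewrite sh_join; apply/joinP; split.
  apply: le_trans (slice_inl_le _ _ _) _; apply: sup_ub; by left.
apply: le_trans (slice_inr_le _ _ _) _; apply: sup_ub; by right.
Qed.

Lemma classifier_ideal_rel f g :
  ideal_rel f g -> classifier_hom f = classifier_hom g.
Proof.
case=> [||a b].
- apply: le_anti; first by apply: sh_mono; apply: le_top.
  rewrite qh_one ts_top; exact: le_top.
- rewrite sh_bot.
  rewrite -[LHS]/(runit Q (qtmap (qh_id Q) (ls_zero R) w)) (opai_zero w_opai).
  exact: sh_bot.
- by rewrite !sh_join; apply: join_le; apply: classifier_add.
Qed.

(** The kernel of [classifier_hom] is a congruence containing the generating relations, so it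
    relates [f] to the top of its class. *)
Lemma classifier_nucleus f :
  classifier_hom (cong_nucleus (@ideal_rel R) f) = classifier_hom f.
Proof.
exact: (@class_top_cong _ (@ideal_rel R) f _ (hom_kernel_congruence classifier_hom)
  classifier_ideal_rel).
Qed.

Definition classifier : quantale_hom (Idl R) Q := quot_factor classifier_nucleus.

(** Both sides have the same dual-basis expansion: by [opai_sigma], [w] comes from
    [Q ⊗ saturated_opens R], and its coefficient at a monoid ideal is the slice of [w] there. *)
Lemma classifier_universal : tmap classifier (qh_id R) u = w.
Proof.
rewrite tmap_comp -[RHS]opai_sigma.
have -> : tmap (sh_id Q) sigma w = tmap (sh_id Q) (kappa R) (tmap (sh_id Q) sat w).
  by rewrite tmap_comp; apply: eq_tmap.
rewrite -(duality_expand (tmap (sh_id Q) sat w) eta_dual) tmap_comp.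
apply: eq_tmap => // I.
have -> : (classifier ∘ frak_s R) I = slice w (sval I : hom R Omega).
  exact: (quot_factorE classifier_nucleus (sval I)).
rewrite /= slice_tmap pair_r_evaluation; congr (slice w _).
apply: sup_hom_eq => a; rewrite -[in LHS](svalP I); exact: mtopE.
Qed.

End Classify.

(** * Representability *)

Definition universal_OPAI : OPAI R (Idl R) := exist _ u universal_is_OPAI.

Lemma universal_OPAI_represents : represents universal_OPAI.
Proof.
exists (fun Q g => OPAI_map g universal_OPAI); split=> [Q Q' g f|Q|].
- exact: OPAI_comp.
- exists (fun w : OPAI R Q => classifier (svalP w)) => [g|w].
    (* Slicing commutes with [g], and slicing [u] is the quotient map, so [g] is recovered from the
       image of [u]. *)
    apply: quantale_hom_eq => x.
    rewrite -[LHS]/(slice (tmap g (sh_id R) u) (sval x : hom R Omega)) slice_tmap.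
    have -> : (sval x : hom R Omega) ∘ sh_id R = sval x by apply: sup_hom_eq.
    rewrite slice_universal; congr (g _); apply: quot_eq; exact: (svalP x).
  by apply: OPAI_obj_eq; apply: classifier_universal.
- exact: OPAI_id.
Qed.

End Universal.
End Overt.

Theorem theorem4p3 (R : localic_semiring)
    (R_overt : overt R) (SR_dualisable : dualisable (saturated_opens R)) :
  exists eta : sup_hom Omega (monoid_ideals R ⊗ saturated_opens R),
    unique (fun eta' => duality eta' (evaluation R)) eta /\
    exists u : OPAI R (Idl R),
      sval u = tmap (frak_s R) (kappa R) (eta (top Omega)) /\ represents u.
Proof.
have [eta d] := evaluation_duality R_overt SR_dualisable.
exists eta; split; first by split=> // eta'; apply: duality_unit_unique.
exists (universal_OPAI R_overt d); split; first by rewrite top_Omega.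
exact: universal_OPAI_represents.
Qed.
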